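(* Assume $\rho_1 < \frac{c_2}{c_1+c_2}$ and $\rho_2 < \frac{c_1}{c_1+c_2}$. The steady-state workload $V_1$ of the first queue is distributed as a sum of two independent random variables, $$V_1 \overset{d}{=} V_{M/G/1} + Y,$$ where $V_{M/G/1}$ is the steady-state amount of work in the corresponding M/G/1 queue and $Y$ is the steady-state amount of work in the first queue when the server is not serving at the first queue. The LST of $Y$ is $$\mathbb{E}(e^{-sY}) = \frac{c_2 - \rho_1 (c_1 + c_2)}{(1 - \rho_1)(c_1 + c_2)}\left[1 - \frac{s c_1}{(c_2 + c_1-s) \lambda_1(1 - \tilde{b}_1(s)) + \left(\lambda_1(1 - \tilde{b}_1(s))\right)^2 - s c_2}\right].$$
   Context: Model (two-queue polling with exponential timers). Customers arrive at queue $i$ according to independent Poisson processes with rates $\lambda_i>0$, $i=1,2$. Service times at queue $i$ are i.i.d. positive random variables distributed as $B_i$, with finite mean and Laplace-Stieltjes transform (LST) $\tilde b_i(s)=\mathbb{E}(e^{-sB_i})$, $\mathrm{Re}\, s\ge 0$. All arrival processes, service times and residing times are independent. A single server alternates between the queues: it stays at queue $i$ for an exponentially distributed residing time $T_i$ with rate $c_i>0$, regardless of the queue contents (it stays even if the queue is empty), and then switches instantaneously to the other queue (no switch-over time). While at queue $i$ the server serves only customers of queue $i$, at unit speed, in first-come-first-served order. A service interrupted by a switch is resumed where it stopped at the next visit (preemptive-resume). $\rho_i=\lambda_i\mathbb{E}(B_i)$. $V_1$ denotes a random variable with the steady-state distribution (at an arbitrary epoch) of the workload of queue 1, i.e. the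 total amount of remaining service time present in queue 1. The corresponding M/G/1 queue is the M/G/1 queue with arrival rate $\lambda_1$ and service times distributed as $B_1$ (first queue in isolation, server always present). ''The server is not serving at the first queue'' means that either the server resides at queue 2, or it resides at queue 1 while queue 1 is empty; $Y$ has the steady-state distribution of the workload of queue 1 conditional on this event. The formula for the LST is for $\mathrm{Re}\, s\ge0$, the value at $s=0$ being understood by continuity. *)

(* Defs.v *)
From HB Require Import structures.
From mathcomp Require Import all_boot all_order all_algebra.
From mathcomp Require Import all_classical all_reals all_analysis.
From mathcomp.real_closed Require Import complex.

Set Implicit Arguments.
Unset Strict Implicit.
Unset Printing Implicit Defensive.

Import Order.TTheory GRing.Theory Num.Theory.
Import numFieldNormedType.Exports.

Local Open Scope classical_set_scope.
Local Open Scope ring_scope.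

(* The two queues are the two booleans, so that the queue other than [i] is
   [~~ i] and queue indices carry the discrete sigma-algebra. *)
Notation queue := bool (only parsing).
Definition queue1 : queue := true.
Definition queue2 : queue := false.

Definition has_law (R : realType) (d d' : measure_display)
    (T : measurableType d) (T' : measurableType d') (P : probability T R)
    (X : T -> T') (m : set T' -> \bar R) : Prop :=
  measurable_fun [set: T] X /\
  forall A : set T', measurable A -> P (X @^-1` A) = m A.

Definition generated (d d' : measure_display) (T : measurableType d)
    (T' : measurableType d') (X : T -> T') : set_system T :=
  preimage_set_system [set: T] X measurable.

(* Product rule over every finite subfamily, enumerated without repetition. *)
Definition mutually_independent (R : realType) (d : measure_display)
    (T : measurableType d) (P : probability T R) (I : Type)
    (F : I -> set_system T) : Prop :=
  forall (n : nat) (i : 'I_n -> I) (E : 'I_n -> set T),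
    injective i -> (forall k, F (i k) (E k)) ->
    P (\bigcap_k E k) = (\prod_(k < n) P (E k))%E.

Definition independent_pair (R : realType) (d d1 d2 : measure_display)
    (T : measurableType d) (T1 : measurableType d1) (T2 : measurableType d2)
    (P : probability T R) (X : T -> T1) (Y : T -> T2) : Prop :=
  forall (A : set T1) (B : set T2), measurable A -> measurable B ->
    P (X @^-1` A `&` Y @^-1` B) = (P (X @^-1` A) * P (Y @^-1` B))%E.

Definition arrival_epoch (R : realType) (inter : nat -> R) (n : nat) : R :=
  \sum_(k < n.+1) inter k.

(* Work present at time t + work done in [0, t]
     = work present at time 0 + work brought in by the arrivals up to t.
   The server works at unit speed exactly when it is present at the queue
   and the queue is nonempty. *)
Definition workload_path (R : realType) (inter serv : nat -> R)
    (present : R -> bool) (v : R -> R) : Prop :=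
  forall t : R, 0 <= t ->
    0 <= v t /\
    ((v t)%:E +
       \int[lebesgue_measure]_(u in `[0%R, t])
         ((present u && (0 < v u)%R)%:R)%:E =
     (v 0%R)%:E +
       \sum_(0 <= n <oo | (arrival_epoch inter n <= t)%R) (serv n)%:E)%E.

Inductive mg1_input : Type :=
| Mg1Initial
| Mg1Interarrival of nat
| Mg1Service of nat.

Definition mg1_generated (R : realType) (d : measure_display)
    (T : measurableType d) (inter serv : nat -> T -> R) (W : R -> T -> R)
    (x : mg1_input) : set_system T :=
  match x with
  | Mg1Initial => generated (W 0)
  | Mg1Interarrival n => generated (inter n)
  | Mg1Service n => generated (serv n)
  end.

Record mg1_process (R : realType) (d : measure_display)
    (T : measurableType d) (P : probability T R)
    (lambda : R) (B : probability R R)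
    (inter serv : nat -> T -> R) (W : R -> T -> R) : Prop := Mg1Process {
  mg1_interarrival_law :
    forall n, has_law P (inter n) (exponential_prob lambda);
  mg1_service_law : forall n, has_law P (serv n) B;
  mg1_independent : mutually_independent P (mg1_generated inter serv W);
  mg1_workload : {ae P, forall w,
    workload_path (inter ^~ w) (serv ^~ w) (fun=> true) (W ^~ w)}
}.

Definition mg1_steady_state (R : realType) (lambda : R)
    (B : probability R R) (mu : probability R R) : Prop :=
  exists (d : measure_display) (T : measurableType d) (P : probability T R)
         (inter serv : nat -> T -> R) (W : R -> T -> R),
    mg1_process P lambda B inter serv W /\
    forall t : R, 0 <= t -> has_law P (W t) mu.

(* Queue visited during the n-th (n = 0, 1, ...) residing period. *)
Definition visited (j0 : queue) (n : nat) : queue :=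
  if odd n then ~~ j0 else j0.

(* Beginning of the n-th residing period; [resid i k] is the length of the
   k-th visit to queue [i].  The residing period in progress at time 0 is
   described by its residual length, which is again exponential. *)
Definition switch_epoch (R : realType) (resid : queue -> nat -> R)
    (j0 : queue) (n : nat) : R :=
  \sum_(k < n) resid (visited j0 k) k./2.

Definition server_path (R : realType) (resid : queue -> nat -> R)
    (j : R -> queue) : Prop :=
  forall (t : R) (n : nat),
    switch_epoch resid (j 0) n <= t < switch_epoch resid (j 0) n.+1 ->
    j t = visited (j 0) n.

(* (workload of queue 1, workload of queue 2, queue where the server is) *)
Definition polling_state (R : realType) (T : Type) (V : queue -> R -> T -> R)
    (J : R -> T -> queue) (t : R) (w : T) : R * R * queue :=
  (V queue1 t w, V queue2 t w, J t w).

Inductive polling_input : Type :=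
| InitialState
| Interarrival of queue & nat
| Service of queue & nat
| Residing of queue & nat.

Definition polling_generated (R : realType) (d : measure_display)
    (T : measurableType d) (inter serv resid : queue -> nat -> T -> R)
    (V : queue -> R -> T -> R) (J : R -> T -> queue)
    (x : polling_input) : set_system T :=
  match x with
  | InitialState => generated (polling_state V J 0)
  | Interarrival i n => generated (inter i n)
  | Service i n => generated (serv i n)
  | Residing i n => generated (resid i n)
  end.

Record polling_process (R : realType) (d : measure_display)
    (T : measurableType d) (P : probability T R)
    (lambda c : queue -> R) (B : queue -> probability R R)
    (inter serv resid : queue -> nat -> T -> R)
    (V : queue -> R -> T -> R) (J : R -> T -> queue) : Prop :=
  PollingProcess {
  polling_interarrival_law :
    forall i n, has_law P (inter i n) (exponential_prob (lambda i));
  polling_service_law : forall i n, has_law P (serv i n) (B i);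
  polling_residing_law :
    forall i n, has_law P (resid i n) (exponential_prob (c i));
  polling_independent :
    mutually_independent P (polling_generated inter serv resid V J);
  polling_server : {ae P, forall w,
    server_path (fun i n => resid i n w) (J ^~ w)};
  polling_workload : forall i, {ae P, forall w,
    workload_path (fun n => inter i n w) (fun n => serv i n w)
      (fun u => J u w == i) (fun t => V i t w)}
}.

Definition polling_steady_state (R : realType) (lambda c : queue -> R)
    (B : queue -> probability R R) (pst : probability (R * R * queue)%type R) :
    Prop :=
  exists (d : measure_display) (T : measurableType d) (P : probability T R)
         (inter serv resid : queue -> nat -> T -> R)
         (V : queue -> R -> T -> R) (J : R -> T -> queue),
    polling_process P lambda c B inter serv resid V J /\
    forall t : R, 0 <= t -> has_law P (polling_state V J t) pst.

Definition workload1 (R : realType) (x : R * R * queue) : R := x.1.1.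

Definition not_serving1 (R : realType) : set (R * R * queue) :=
  [set x | x.2 = queue2 \/ (x.2 = queue1 /\ workload1 x = 0)].

Definition is_conditional_law (R : realType) (d d' : measure_display)
    (T : measurableType d) (T' : measurableType d') (P : probability T R)
    (X : T -> T') (E : set T) (nu : probability T' R) : Prop :=
  forall A : set T', measurable A ->
    nu A = (P (X @^-1` A `&` E) / P E)%E.

Definition mean (R : realType) (B : probability R R) : \bar R :=
  (\int[B]_x x%:E)%E.

(* e^{-sx} = e^{-x Re s} (cos (x Im s) - i sin (x Im s)), integrated
   componentwise. *)
Definition LST (R : realType) (m : probability R R) (s : R[i]) : R[i] :=
  Complex (\int[m]_x (expR (- (complex.Re s * x)) * cos (complex.Im s * x)))
          (- \int[m]_x (expR (- (complex.Re s * x)) * sin (complex.Im s * x))).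

(* Main.v *)
Require Import Defs.
From HB Require Import structures.
From mathcomp Require Import all_boot all_order all_algebra.
From mathcomp Require Import all_classical all_reals all_analysis.
From mathcomp.real_closed Require Import complex.
From mathcomp Require Import measurable_realfun ring lra.

(* Both workload processes are stationary, so the expectation of a smooth test
   function at time h equals its value at time 0.  Up to O(h^2), only three
   things can happen in [0, h]: nothing (the workload drains if the server is
   present), one arrival, or one switch; their probabilities only involve the
   first two interarrival times, the first service time and the two first
   residing times.  Dividing by h gives the balance equations
     s (phi_1 - p0) = (alpha + c1) phi_1 - c2 phi_2,
     (alpha + c2) phi_2 = c1 phi_1,       alpha(s) = lambda_1 (1 - b_1(s)),
   where phi_j(s) = E(e^{-s V_1}; server at queue j) and p0 is the probability
   that the server is idle at queue 1; the same argument without switches gives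
   (s - alpha) psi = s (1 - rho_1) for the M/G/1 queue.  Letting s tend to 0
   yields p0 = c2/(c1+c2) - rho_1; the LST of Y is (p0 + phi_2)/(1 - rho_1), and
   psi E(e^{-sY}) = phi_1 + phi_2, so that uniqueness of Laplace transforms at
   the integers gives the decomposition. *)

Set Implicit Arguments.
Unset Strict Implicit.
Unset Printing Implicit Defensive.

Import Order.TTheory GRing.Theory Num.Theory.
Import numFieldNormedType.Exports.

Local Open Scope classical_set_scope.
Local Open Scope ring_scope.

(** * Expectations of bounded random variables *)

(** The hypotheses describe paths, not a Markov semigroup, and stationarity enters only as equality
    of the laws at times 0 and [h]. The generator is therefore extracted by hand from the
    independence of the initial state and the inputs: accidents in [[0, h]] are expressed through
    clocks independent of the state, and the error is a sum of products of clock probabilities, with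
    a constant depending only on a bound and a Lipschitz constant of the test function. The term
    [p0] has its origin in the drift: an empty queue does not drain, so the derivative of [e^(-s v)]
    is integrated over positive workloads only and the value 1 at [v = 0] is missing. That the
    denominator does not vanish is read off the equations themselves: eliminating [phi_2] gives
    [den phi_1 = - s p0 (alpha + c2)], where [Re (alpha + c2) > 0] and [p0 > 0] is precisely the
    condition on [rho_1]. In the same way [(s - alpha) psi = s (1 - rho_1)] shows that [s - alpha]
    is nonzero at positive integers, which allows the decomposition to be checked after
    multiplication by it. *)

Section bounded_measurable.
Context {R : realType} {d : measure_display} {T : measurableType d}.
Implicit Types f g : T -> R.

(** Unlike integrability, this class is stable under products, and under a probability it implies
    integrability; the test functions are truncated so as to belong to it. *)
Definition bounded_measurable f :=
  measurable_fun [set: T] f /\ exists K, forall x, `|f x| <= K.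

Lemma bounded_measurable_cst (r : R) : bounded_measurable (fun=> r).
Proof. by split; [exact: measurable_cst|exists `|r|]. Qed.

Lemma bounded_measurableD f g : bounded_measurable f -> bounded_measurable g ->
  bounded_measurable (fun x => f x + g x).
Proof.
move=> [mf [K fK]] [mg [L gL]]; split; first exact: measurable_funD.
by exists (K + L) => x; rewrite (le_trans (ler_normD _ _))// lerD.
Qed.

Lemma bounded_measurableN f : bounded_measurable f ->
  bounded_measurable (fun x => - f x).
Proof.
move=> [mf [K fK]]; split; first exact: measurableT_comp.
by exists K => x; rewrite normrN.
Qed.

Lemma bounded_measurableB f g : bounded_measurable f -> bounded_measurable g ->
  bounded_measurable (fun x => f x - g x).
Proof.
by move=> mf /bounded_measurableN; exact: bounded_measurableD.
Qed.

Lemma bounded_measurableM f g : bounded_measurable f -> bounded_measurable g ->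
  bounded_measurable (fun x => f x * g x).
Proof.
move=> [mf [K fK]] [mg [L gL]]; split; first exact: measurable_funM.
by exists (K * L) => x; rewrite normrM ler_pM.
Qed.

Lemma bounded_measurable_norm f : bounded_measurable f ->
  bounded_measurable (fun x => `|f x|).
Proof.
move=> [mf [K fK]]; split; first exact: measurableT_comp.
by exists K => x; rewrite normr_id.
Qed.

Lemma bounded_measurable_bool (b : T -> bool) : measurable_fun [set: T] b ->
  bounded_measurable (fun x => (b x)%:R).
Proof.
move=> mb; split; last by exists 1 => x; case: (b x); rewrite ?normr1 ?normr0.
by apply: (@measurableT_comp _ _ _ _ _ _ (fun c : bool => c%:R : R)).
Qed.

End bounded_measurable.

Lemma bounded_measurable_eqb {R : realType} {d : measure_display}
    {T : measurableType d} (J : T -> bool) (j : bool) :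
  measurable_fun [set: T] J -> bounded_measurable (fun w => (J w == j)%:R : R).
Proof.
move=> mJ; apply: bounded_measurable_bool.
exact: (measurableT_comp (f := fun k : bool => k == j) _ mJ).
Qed.

Lemma max0_ge0 {R : realType} (x : R) : 0 <= Num.max x 0.
Proof. by rewrite le_max lexx orbT. Qed.

Lemma bounded_measurable_comp {R : realType} {d d' : measure_display}
    {T : measurableType d} {T' : measurableType d'} (f : T' -> R) (X : T -> T') :
  bounded_measurable f -> measurable_fun [set: T] X ->
  bounded_measurable (fun x => f (X x)).
Proof.
move=> [mf [K fK]] mX; split; first exact: measurableT_comp.
by exists K.
Qed.

Section expectation.
Context {R : realType} {d : measure_display} {T : measurableType d}.
Variable P : probability T R.
Implicit Types f g : T -> R.

Lemma bounded_measurable_integrable f : bounded_measurable f ->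
  P.-integrable [set: T] (EFin \o f).
Proof.
move=> [mf [K fK]]; apply: measurable_bounded_integrable => //.
  by rewrite /= probability_setT ltry.
exists K; split; first exact: num_real.
by move=> x Kx y _; apply: le_trans (ltW Kx); exact: fK.
Qed.

Lemma expectD f g : bounded_measurable f -> bounded_measurable g ->
  \int[P]_x (f x + g x) = \int[P]_x f x + \int[P]_x g x.
Proof. by move=> *; apply: RintegralD => //; exact: bounded_measurable_integrable. Qed.

Lemma expectB f g : bounded_measurable f -> bounded_measurable g ->
  \int[P]_x (f x - g x) = \int[P]_x f x - \int[P]_x g x.
Proof. by move=> *; apply: RintegralB => //; exact: bounded_measurable_integrable. Qed.

Lemma expectZl (r : R) f : bounded_measurable f ->
  \int[P]_x (r * f x) = r * \int[P]_x f x.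
Proof. by move=> *; apply: RintegralZl => //; exact: bounded_measurable_integrable. Qed.

Lemma expectN f : bounded_measurable f ->
  \int[P]_x (- f x) = - \int[P]_x f x.
Proof.
by move=> bf; rewrite -mulN1r -expectZl//; apply: eq_Rintegral => x _; rewrite mulN1r.
Qed.

Lemma expect_cst (r : R) : \int[P]_x (cst r x) = r.
Proof. by rewrite Rintegral_cst// [X in fine X]probability_setT mulr1. Qed.

Lemma ae_eq_expect f g : measurable_fun [set: T] f -> measurable_fun [set: T] g ->
  {ae P, forall x, f x = g x} -> \int[P]_x f x = \int[P]_x g x.
Proof.
move=> mf mg fg; congr fine; apply: ae_eq_integral => //; try exact/measurable_EFinP.
by apply: filterS fg => x -> _.
Qed.

Lemma ae_le_expect f g : bounded_measurable f -> bounded_measurable g ->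
  {ae P, forall x, f x <= g x} -> \int[P]_x f x <= \int[P]_x g x.
Proof.
move=> bf bg fg; rewrite -subr_ge0 -expectB//.
have b0 := bounded_measurableB bg bf.
rewrite (@ae_eq_expect _ (fun x => `|g x - f x|)).
- by apply: Rintegral_ge0 => x _.
- exact: b0.1.
- by have [] := bounded_measurable_norm b0.
- by apply: filterS fg => x fg; rewrite ger0_norm// subr_ge0.
Qed.

Lemma expect_norm_le f : bounded_measurable f ->
  `|\int[P]_x f x| <= \int[P]_x `|f x|.
Proof.
by move=> bf; apply: le_normr_Rintegral => //; exact: bounded_measurable_integrable.
Qed.

Lemma expect_has_law {d' : measure_display} {T' : measurableType d'}
    (X : T -> T') (Q : probability T' R) (f : T' -> R) :
  has_law P X Q -> bounded_measurable f ->
  \int[P]_x f (X x) = \int[Q]_y f y.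
Proof.
move=> [mX XQ] bf; rewrite /Rintegral; congr fine.
transitivity (\int[pushforward P X]_y (f y)%:E)%E.
  rewrite integral_pushforward//=; first exact/measurable_EFinP/bf.1.
  exact/bounded_measurable_integrable/(bounded_measurable_comp bf).
by apply: eq_measure_integral => A mA _; exact: XQ.
Qed.

Lemma expect_bool (b : T -> bool) (A : set T) : measurable A ->
  (forall x, b x <-> A x) -> \int[P]_x ((b x)%:R : R) = fine (P A).
Proof.
move=> mA bA; rewrite /Rintegral -[in RHS](setIT A) -integral_indic//.
congr fine; apply: eq_integral => x _; rewrite indicE.
by have -> : (x \in A) = b x by apply/idP/idP; rewrite inE bA.
Qed.

Lemma dominated_expect (f_ : nat -> T -> R) f (K : R) :
  (forall n, measurable_fun [set: T] (f_ n)) ->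
  {ae P, forall x, forall n, `|f_ n x| <= K} ->
  {ae P, forall x, f_ n x @[n --> \oo] --> f x} ->
  measurable_fun [set: T] f ->
  \int[P]_x f_ n x @[n --> \oo] --> \int[P]_x f x.
Proof.
move=> mf_ f_K f_f mf.
have := @dominated_convergence _ T R P setT measurableT (fun n => EFin \o f_ n)
  (EFin \o f) (EFin \o cst K).
case=> //.
- by move=> n; exact/measurable_EFinP.
- exact/measurable_EFinP.
- by apply: filterS f_f => x h _; apply: cvg_EFin => //; exact: nearW.
- exact/bounded_measurable_integrable/bounded_measurable_cst.
- by apply: filterS f_K => x f_K n _ /=; rewrite lee_fin.
- move=> intf _ h; apply: fine_cvg => /=; rewrite fineK//.
  exact: integrable_fin_num.
Qed.

End expectation.

(** * Independence *)

Section independence.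
Context {R : realType} {d : measure_display} {T : measurableType d}.
Variable P : probability T R.

Lemma mutually_independent2 (I : Type) (F : I -> set_system T) (i j : I)
    (A B : set T) : mutually_independent P F -> i <> j -> F i A -> F j B ->
  P (A `&` B) = (P A * P B)%E.
Proof.
move=> indep ij FA FB.
have := indep 2 (fun k : 'I_2 => if val k == 0 then i else j)
  (fun k : 'I_2 => if val k == 0 then A else B).
have -> : \bigcap_(k : 'I_2) (if val k == 0 then A else B) = A `&` B.
  apply/seteqP; split => [x AB|x [Ax Bx] k _]; last by case: ifP.
  by split; [have := AB ord0 Logic.I|have := AB ord_max Logic.I].
rewrite !big_ord_recl big_ord0 mule1 /=; apply; last by move=> k; case: ifP.
by move=> [[|[|//]] ?] [[|[|//]] ?] /= ?; apply: val_inj => //=; exfalso; apply: ij.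
Qed.

Lemma mutually_independent3 (I : Type) (F : I -> set_system T) (i j k : I)
    (A B C : set T) : mutually_independent P F -> i <> j -> i <> k -> j <> k ->
  F i A -> F j B -> F k C -> P (A `&` B `&` C) = (P A * P B * P C)%E.
Proof.
move=> indep ij ik jk FA FB FC.
have := indep 3 (fun l : 'I_3 => nth i [:: i; j; k] (val l))
  (fun l : 'I_3 => nth A [:: A; B; C] (val l)).
have -> : \bigcap_(l : 'I_3) nth A [:: A; B; C] (val l) = A `&` B `&` C.
  apply/seteqP; split => [x ABC|x [[Ax Bx] Cx] [[|[|[|//]]] ?] _] //.
  split; last exact: (ABC ord_max Logic.I).
  split; first exact: (ABC ord0 Logic.I).
  exact: (ABC (@Ordinal 3 1 isT) Logic.I).
rewrite !big_ord_recl big_ord0 mule1 /= muleA; apply.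
  by move=> [[|[|[|//]]] ?] [[|[|[|//]]] ?] /= e; apply: val_inj => //=;
    exfalso; by [exact: ij|exact: ik|exact: jk|exact: ij (esym e)
                |exact: ik (esym e)|exact: jk (esym e)].
by move=> [[|[|[|//]]] ?].
Qed.

Context {d1 d2 d3 : measure_display} {T1 : measurableType d1}
  {T2 : measurableType d2} {T3 : measurableType d3}.

Lemma independent_pairC (X : T -> T1) (Y : T -> T2) :
  independent_pair P X Y -> independent_pair P Y X.
Proof. by move=> XY A B mA mB; rewrite setIC XY// muleC. Qed.

Lemma independent_pair_comp (X : T -> T1) (Y : T -> T2) (g : T2 -> T3) :
  measurable_fun [set: T2] g -> independent_pair P X Y ->
  independent_pair P X (g \o Y).
Proof.
move=> mg XY A B mA mB; rewrite comp_preimage XY//.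
by rewrite -[_ @^-1` _]setTI; exact: mg.
Qed.

(** The joint law of [(X, Y)] agrees with the product of the two laws on rectangles, hence
    everywhere, and Fubini separates the factors. *)
Lemma independent_pair_expectM (X : T -> T1) (Y : T -> T2) (f : T1 -> R)
    (g : T2 -> R) :
  measurable_fun [set: T] X -> measurable_fun [set: T] Y ->
  independent_pair P X Y -> bounded_measurable f -> bounded_measurable g ->
  \int[P]_w (f (X w) * g (Y w)) = \int[P]_w f (X w) * \int[P]_w g (Y w).
Proof.
move=> mX mY XY bf bg.
pose X' : {mfun T >-> T1} := HB.pack X (isMeasurableFun.Build _ _ _ _ X mX).
pose Y' : {mfun T >-> T2} := HB.pack Y (isMeasurableFun.Build _ _ _ _ Y mY).
pose m1 : probability T1 R := distribution P X'.
pose m2 : probability T2 R := distribution P Y'.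
have mXY : measurable_fun [set: T] (fun w => (X w, Y w)).
  exact: measurable_fun_pair.
have bfg : bounded_measurable (fun z : T1 * T2 => f z.1 * g z.2).
  by apply: bounded_measurableM;
    [apply: (bounded_measurable_comp bf)|apply: (bounded_measurable_comp bg)].
have lXY : has_law P (fun w => (X w, Y w)) (m1 \x m2)%E.
  split=> // D mD.
  pose XY' : {mfun T >-> (T1 * T2)%type} :=
    HB.pack (fun w => (X w, Y w)) (isMeasurableFun.Build _ _ _ _ _ mXY).
  by rewrite (@product_measure_unique _ _ _ _ _ m1 m2 (distribution P XY')).
rewrite (expect_has_law lXY bfg).
have intfg := bounded_measurable_integrable (m1 \x m2)%E bfg.
rewrite /Rintegral -integral12_prod_meas1//.
have lX : has_law P X m1 by split.
have lY : has_law P Y m2 by split.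
rewrite -!/(Rintegral _ _ _) (expect_has_law lX bf) (expect_has_law lY bg).
transitivity (\int[m1]_x (f x * \int[m2]_y g y)).
  congr fine; apply: eq_integral => x _.
  rewrite /fubini_F/= -(expectZl _ _ bg) /Rintegral fineK//.
  apply: integrable_fin_num => //.
  by apply/bounded_measurable_integrable/bounded_measurableM => //;
    exact: bounded_measurable_cst.
by under eq_Rintegral do rewrite mulrC; rewrite expectZl// mulrC.
Qed.

(** For fixed [C], both sides are finite measures in [D] that agree on rectangles, a generating
    class closed under intersection. The triple version is needed because an arrival involves the
    initial state, the service time and the arrival clock at once. *)
Lemma independent_pair_triple (X : T -> T1) (Y : T -> T2) (Z : T -> T3) :
  measurable_fun [set: T] X -> measurable_fun [set: T] Y ->
  measurable_fun [set: T] Z ->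
  (forall A B C, measurable A -> measurable B -> measurable C ->
    P (X @^-1` A `&` Y @^-1` B `&` Z @^-1` C) =
    (P (X @^-1` A) * P (Y @^-1` B) * P (Z @^-1` C))%E) ->
  independent_pair P (fun w => (X w, Y w)) Z.
Proof.
move=> mX mY mZ XYZ D C mD mC.
have mXY : measurable_fun [set: T] (fun w => (X w, Y w)).
  exact: measurable_fun_pair.
have mZC : measurable (Z @^-1` C) by rewrite -[_ @^-1` _]setTI; exact: mZ.
pose XY' : {mfun T >-> (T1 * T2)%type} :=
  HB.pack (fun w => (X w, Y w)) (isMeasurableFun.Build _ _ _ _ _ mXY).
pose m1 := pushforward (mrestr P mZC) XY'.
pose r : {nonneg R} := NngNum (fine_ge0 (measure_ge0 P (Z @^-1` C))).
pose m2 := mscale r (distribution P XY').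
have m2E E : m2 E = (P (XY' @^-1` E) * P (Z @^-1` C))%E.
  by rewrite /m2 /mscale/= fineK ?fin_num_measure// muleC.
pose G := [set A `*` B | A in measurable & B in measurable] : set_system (T1 * T2).
suff e : m1 D = m2 D by exact: etrans e (m2E D).
apply: (@measure_unique _ _ _ G (fun=> setT)) => //.
- by rewrite measurable_prod_measurableType.
- move=> _ _ [A1 mA1 [B1 mB1 <-]] [A2 mA2 [B2 mB2 <-]]; rewrite -setXI.
  by exists (A1 `&` A2); [exact: measurableI|exists (B1 `&` B2) => //; exact: measurableI].
- by move=> _; exists setT => //; exists setT => //; rewrite setXTT.
- by rewrite bigcup_const.
- move=> _ [A mA [B mB <-]]; apply: etrans (esym (m2E _)).
  (* Taking [C = setT] in the triple rule gives the product rule for [X] and [Y] alone. *)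
  have := XYZ A B setT mA mB measurableT.
  rewrite preimage_setT setIT probability_setT mule1 => XY.
  transitivity (P (X @^-1` A `&` Y @^-1` B `&` Z @^-1` C)); first by [].
  by rewrite XYZ// -XY.
- move=> _; apply: le_lt_trans (ltry 1%R).
  exact: (probability_le1 P (measurableI _ _ (measurableT) mZC)).
Qed.

End independence.

(** * The process during a short time interval *)

Section one_step.
Context {R : realType}.

Definition drift (h : R) (j : bool) (v : R) := if j then Num.max (v - h) 0 else v.

Lemma drift_dist h j v : 0 <= h -> 0 <= v -> `|drift h j v - v| <= h.
Proof.
rewrite /drift => h0 v0; case: j; last by rewrite subrr normr0.
by case: (leP (v - h) 0) => ? /=; rewrite ler_norml; apply/andP; split; lra.
Qed.

Variables (f : bool -> R -> R) (K L : R).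
Hypothesis fL : forall j x y, `|f j x - f j y| <= L * `|x - y|.

Lemma lip_ge0 : 0 <= L.
Proof. by have := fL true 1 0; rewrite subr0 normr1 mulr1; apply: le_trans. Qed.

Hypothesis fK : forall j v, `|f j v| <= K.

(** Here [a] and [a2] stand for a first and a second interarrival time at most [h], and [b j] for a
    first residing time at queue [j] at most [h]. Without an arrival or a switch the expansion is
    exact. With a single one of them it is off by two displacements of size at most [h], which cost
    [2 * L * h]. When two occur, the trivial bound [8 * K] is charged to a product of two
    indicators. *)
Lemma one_step_bound (h v vh s : R) (j jh a a2 : bool) (b : bool -> bool) :
  0 <= h -> 0 <= v ->
  (~~ a -> ~~ b j -> jh = j /\ vh = drift h j v) ->
  (a -> ~~ a2 -> ~~ b j -> jh = j /\ `|vh - (v + s)| <= h) ->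
  (~~ a -> b j -> ~~ b (~~ j) -> jh = ~~ j /\ `|vh - v| <= h) ->
  `|f jh vh - f j v - ((f j (drift h j v) - f j v)
     + a%:R * (f j (v + s) - f j v) + (b j)%:R * (f (~~ j) v - f j v))| <=
  (8 * K + 2 * L) * (h * (a%:R + (b true)%:R + (b false)%:R) + a%:R * a2%:R
     + a%:R * (b true)%:R + a%:R * (b false)%:R + (b true)%:R * (b false)%:R).
Proof.
move=> h0 v0 H0 H1 H2.
have K0 : 0 <= K by apply: le_trans (fK true 0).
have L0 := lip_ge0.
have C0 : 0 <= 8 * K + 2 * L by lra.
have Ch : 0 <= (8 * K + 2 * L) * h by rewrite mulr_ge0.
have fh : `|f j (drift h j v) - f j v| <= L * h.
  by rewrite (le_trans (fL _ _ _))// ler_wpM2l// drift_dist.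
have Kh : 0 <= K * h by rewrite mulr_ge0.
have LhC : L * h + L * h <= (8 * K + 2 * L) * h by lra.
set rhs := (X in _ <= X).
set lhs := (X in `|X|).
(* [lhs] is made of four differences of values of [f], each at most [2 * K]. *)
have lhs8 : `|lhs| <= 8 * K.
  have fb (i : bool) x y : `|f i x - f j y| <= 2 * K.
    by rewrite (le_trans (ler_normB _ _))//; have := fK i x; have := fK j y; lra.
  have fb' (i : bool) k x y : `|i%:R * (f k x - f j y)| <= 2 * K.
    by rewrite normrM; case: i; rewrite ?normr1 ?mul1r ?fb// normr0 mul0r; lra.
  rewrite /lhs (_ : 8 * K = 2 * K + (2 * K + 2 * K + 2 * K)); last by lra.
  apply: le_trans (ler_normB _ _) _.
  by rewrite lerD ?fb// (le_trans (ler_normD _ _))// lerD ?fb'//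
    (le_trans (ler_normD _ _))// lerD ?fb'.
(* Used when two events occur: the factor of [8 * K + 2 * L] in [rhs] is then at least 1. *)
have big : 8 * K + 2 * L <= rhs -> `|lhs| <= rhs.
  by apply: le_trans; rewrite (le_trans lhs8)//; lra.
have e2 (x y : R) : `|x| <= L * h -> `|y| <= L * h -> `|x - y| <= (8 * K + 2 * L) * h.
  by move=> ? ?; rewrite (le_trans (ler_normB _ _))//; lra.
have mono (x y : R) : `|x - y| <= h -> forall i, `|f i x - f i y| <= L * h.
  by move=> ? i; rewrite (le_trans (fL _ _ _))// ler_wpM2l.
case: (boolP a) => a_; last first.
  case: (boolP (b j)) => bj; last first.
    have [ej ev] := H0 a_ bj.
    have -> : lhs = 0 by rewrite /lhs ej ev (negbTE a_) (negbTE bj) /= ?mulr0n ?mulr1n; ring.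
    rewrite normr0 /rhs mulr_ge0// ?addr_ge0 ?mulr_ge0 ?addr_ge0//.
  case: (boolP (b (~~ j))) => bj'.
    apply: big; rewrite /rhs ler_peMr// (negbTE a_).
    by move: bj bj'; case: (j) => /= -> ->; rewrite /=; lra.
  have [ej ev] := H2 a_ bj bj'.
  have -> : lhs = (f (~~ j) vh - f (~~ j) v) - (f j (drift h j v) - f j v).
    by rewrite /lhs ej bj (negbTE a_) /= ?mulr0n ?mulr1n; ring.
  apply: le_trans (e2 _ _ (mono _ _ ev _) fh) _.
  rewrite /rhs (negbTE a_) ler_wpM2l//.
  by move: bj bj'; case: (j) => /= -> /negbTE ->; rewrite /=; lra.
case: (boolP (b j)) => bj.
  apply: big; rewrite /rhs ler_peMr// a_.
  move: bj; case: (j) => -> /=; case: (b _); case: (a2) => /=; lra.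
case: (boolP a2) => a2_.
  apply: big; rewrite /rhs ler_peMr// a_ a2_ /=.
  case: (b true); case: (b false) => /=; lra.
have [ej ev] := H1 a_ a2_ bj.
have -> : lhs = (f j vh - f j (v + s)) - (f j (drift h j v) - f j v).
  by rewrite /lhs ej a_ (negbTE bj) /= ?mulr0n ?mulr1n; ring.
apply: le_trans (e2 _ _ (mono _ _ ev _) fh) _.
rewrite /rhs a_ (negbTE a2_) ler_wpM2l//.
move: bj; case: (j) => /negbTE ->; case: (b _) => /=; lra.
Qed.

Hypothesis mf : forall j, measurable_fun [set: R] (f j).

Lemma bounded_measurable_state : bounded_measurable (fun x : R * bool => f x.2 x.1).
Proof.
split; last by exists K => x; exact: fK.
rewrite (_ : (fun _ => _) = (fun x : R * bool =>
    (x.2)%:R * f true x.1 + (~~ x.2)%:R * f false x.1)); last first.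
  by apply/funext => -[x []] /=; rewrite ?mul1r ?mul0r ?addr0 ?add0r.
apply: measurable_funD; apply: measurable_funM.
- by apply: (@measurableT_comp _ _ _ _ _ _ (fun c : bool => c%:R : R)).
- exact: measurableT_comp.
- by apply: (@measurableT_comp _ _ _ _ _ _ (fun c : bool => (~~ c)%:R : R)).
- exact: measurableT_comp.
Qed.

Lemma measurable_drift h j : measurable_fun [set: R] (drift h j).
Proof.
rewrite /drift; case: j => //.
by apply: measurable_maxr => //; exact: measurable_funB.
Qed.

Lemma bounded_measurable_drift h :
  bounded_measurable (fun x : R * bool => f x.2 (drift h x.2 x.1) - f x.2 x.1).
Proof.
apply: bounded_measurableB; last exact: bounded_measurable_state.
split; last by exists K => x; exact: fK.
rewrite (_ : (fun _ => _) = (fun x : R * bool =>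
    (x.2)%:R * f true (drift h true x.1) + (~~ x.2)%:R * f false (drift h false x.1))).
  apply: measurable_funD; apply: measurable_funM.
  - by apply: (@measurableT_comp _ _ _ _ _ _ (fun c : bool => c%:R : R)).
  - by apply: measurableT_comp => //; apply: measurableT_comp => //; exact: measurable_drift.
  - by apply: (@measurableT_comp _ _ _ _ _ _ (fun c : bool => (~~ c)%:R : R)).
  - by apply: measurableT_comp => //; apply: measurableT_comp => //; exact: measurable_drift.
by apply/funext => -[x []] /=; rewrite ?mul1r ?mul0r ?addr0 ?add0r.
Qed.

Context {d : measure_display} {T : measurableType d} (P : probability T R).
Variables (V0 S : T -> R) (J0 : T -> bool).
Hypothesis mV0 : measurable_fun [set: T] V0.
Hypothesis mS : measurable_fun [set: T] S.
Hypothesis mJ0 : measurable_fun [set: T] J0.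

(** [drift_term], [jump_term] and [switch_term] are the expected changes of [f] caused by draining
    for a time [h], by one arrival, and by one switch away from queue [j]. The probabilities of the
    last two events are kept apart as factors. *)
Definition drift_term h :=
  \int[P]_w (f (J0 w) (drift h (J0 w) (V0 w)) - f (J0 w) (V0 w)).
Definition jump_term :=
  \int[P]_w (f (J0 w) (V0 w + S w) - f (J0 w) (V0 w)).
Definition switch_term (j : bool) :=
  \int[P]_w ((J0 w == j)%:R * (f (~~ j) (V0 w) - f j (V0 w))).

Definition mass (e : T -> bool) : R := \int[P]_w ((e w)%:R : R).

(** The pathwise bound is integrated: the equality of the expectations of [f] at the two times
    removes the difference on the left, and independence turns clock indicators into factors. *)
Lemma one_step_expect (h : R) (Vh : T -> R) (Jh a a2 : T -> bool)
    (b : bool -> T -> bool) :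
  0 <= h ->
  measurable_fun [set: T] Vh -> measurable_fun [set: T] Jh ->
  measurable_fun [set: T] a -> measurable_fun [set: T] a2 ->
  (forall j, measurable_fun [set: T] (b j)) ->
  {ae P, forall w, [/\ 0 <= V0 w,
    ~~ a w -> ~~ b (J0 w) w -> Jh w = J0 w /\ Vh w = drift h (J0 w) (V0 w),
    a w -> ~~ a2 w -> ~~ b (J0 w) w ->
      Jh w = J0 w /\ `|Vh w - (V0 w + S w)| <= h &
    ~~ a w -> b (J0 w) w -> ~~ b (~~ J0 w) w ->
      Jh w = ~~ J0 w /\ `|Vh w - V0 w| <= h]} ->
  \int[P]_w f (Jh w) (Vh w) = \int[P]_w f (J0 w) (V0 w) ->
  independent_pair P (fun w => ((V0 w, J0 w), S w)) a ->
  (forall j, independent_pair P (fun w => (V0 w, J0 w)) (b j)) ->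
  independent_pair P a a2 ->
  (forall j, independent_pair P a (b j)) ->
  independent_pair P (b true) (b false) ->
  `|drift_term h + mass a * jump_term
     + mass (b true) * switch_term true + mass (b false) * switch_term false| <=
  (8 * K + 2 * L) * (h * (mass a + mass (b true) + mass (b false)) + mass a * mass a2
     + mass a * mass (b true) + mass a * mass (b false) + mass (b true) * mass (b false)).
Proof.
move=> h0 mVh mJh ma ma2 mb path stat iXa iXb iaa iab ibb; pose p := mass; rewrite -!/(p _).
have bbool (e : T -> bool) : measurable_fun [set: T] e ->
    bounded_measurable (fun w => (e w)%:R : R).
  exact: bounded_measurable_bool.
have mX : measurable_fun [set: T] (fun w => (V0 w, J0 w)) by exact: measurable_fun_pair.
have bX : bounded_measurable (fun w => f (J0 w) (V0 w)).
  exact: (bounded_measurable_comp bounded_measurable_state mX).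
have bh : bounded_measurable (fun w => f (Jh w) (Vh w)).
  apply: (bounded_measurable_comp bounded_measurable_state (X := fun w => (Vh w, Jh w))).
  exact: measurable_fun_pair.
have bS : bounded_measurable (fun x : (R * bool) * R =>
    f x.1.2 (x.1.1 + x.2) - f x.1.2 x.1.1).
  apply: bounded_measurableB.
    apply: (bounded_measurable_comp bounded_measurable_state
      (X := fun x : (R * bool) * R => (x.1.1 + x.2, x.1.2))).
    apply: measurable_fun_pair; last exact: measurableT_comp.
    by apply: measurable_funD => //; exact: measurableT_comp.
  exact: (bounded_measurable_comp bounded_measurable_state (X := fst)).
have bD := bounded_measurable_drift h.
have bW j : bounded_measurable (fun x : R * bool =>
    (x.2 == j)%:R * (f (~~ j) x.1 - f j x.1)).
  apply: bounded_measurableM; first exact: bounded_measurable_eqb.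
  by apply: bounded_measurableB; (split; [exact: measurableT_comp|by exists K]).
have bSw : bounded_measurable (fun w => f (J0 w) (V0 w + S w) - f (J0 w) (V0 w)).
  apply: (bounded_measurable_comp bS (X := fun w => ((V0 w, J0 w), S w))).
  exact: measurable_fun_pair.
have bDw : bounded_measurable (fun w => f (J0 w) (drift h (J0 w) (V0 w)) - f (J0 w) (V0 w)).
  exact: (bounded_measurable_comp bD mX).
have bWw j : bounded_measurable (fun w => (J0 w == j)%:R * (f (~~ j) (V0 w) - f j (V0 w))).
  exact: (bounded_measurable_comp (bW j) mX).
have bM (e : T -> bool) (g : T -> R) : measurable_fun [set: T] e -> bounded_measurable g ->
    bounded_measurable (fun w => (e w)%:R * g w).
  by move=> me bg; apply: bounded_measurableM => //; exact: bbool.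
have id1 : bounded_measurable (fun c : bool => c%:R : R).
  exact: (@bounded_measurable_bool _ _ bool id).
have Ea : \int[P]_w ((a w)%:R * (f (J0 w) (V0 w + S w) - f (J0 w) (V0 w))) = p a * jump_term.
  rewrite mulrC /jump_term.
  have := independent_pair_expectM _ ma iXa bS id1.
  rewrite /= => <-; last by exact: measurable_fun_pair.
  by apply: eq_Rintegral => w _; rewrite mulrC.
have Eb j : \int[P]_w ((b j w)%:R * ((J0 w == j)%:R * (f (~~ j) (V0 w) - f j (V0 w))))
    = p (b j) * switch_term j.
  rewrite mulrC /switch_term.
  have := independent_pair_expectM mX (mb j) (iXb j) (bW j) id1.
  by rewrite /= => <-; apply: eq_Rintegral => w _; rewrite mulrC.
have E2 (e1 e2 : T -> bool) : measurable_fun [set: T] e1 -> measurable_fun [set: T] e2 ->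
    independent_pair P e1 e2 -> \int[P]_w ((e1 w)%:R * (e2 w)%:R) = p e1 * p e2.
  by move=> m1 m2 i12; exact: (independent_pair_expectM m1 m2 i12 id1 id1).
(* The relevant clock [b (J0 w)] is selected by the state. Splitting by the value of [J0 w] leaves
   fixed clocks, to which independence applies. *)
pose lhs w := f (Jh w) (Vh w) - f (J0 w) (V0 w)
  - ((f (J0 w) (drift h (J0 w) (V0 w)) - f (J0 w) (V0 w))
   + (a w)%:R * (f (J0 w) (V0 w + S w) - f (J0 w) (V0 w))
   + ((b true w)%:R * ((J0 w == true)%:R * (f (~~ true) (V0 w) - f true (V0 w)))
    + (b false w)%:R * ((J0 w == false)%:R * (f (~~ false) (V0 w) - f false (V0 w))))).
pose rhs w : R := (8 * K + 2 * L) * (h * ((a w)%:R + (b true w)%:R + (b false w)%:R)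
   + (a w)%:R * (a2 w)%:R + (a w)%:R * (b true w)%:R + (a w)%:R * (b false w)%:R
   + (b true w)%:R * (b false w)%:R).
have blhs : bounded_measurable lhs.
  by apply: bounded_measurableB; [exact: bounded_measurableB|
    apply: bounded_measurableD; [apply: bounded_measurableD|apply: bounded_measurableD]];
    rewrite //; apply: bM.
have brhs : bounded_measurable rhs.
  apply: bounded_measurableM; first exact: bounded_measurable_cst.
  do 4 (apply: bounded_measurableD; last by apply: bM => //; exact: bbool).
  apply: bounded_measurableM; first exact: bounded_measurable_cst.
  by do 2 (apply: bounded_measurableD; last exact: bbool); exact: bbool.
have : {ae P, forall w, `|lhs w| <= rhs w}.
  apply: filterS path => w [v0 H0 H1 H2].
  apply: le_trans (one_step_bound (s := S w) (b := b ^~ w) h0 v0 H0 H1 H2).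
  rewrite /lhs le_eqVlt; apply/orP; left; apply/eqP; congr `|_ - (_ + _)|.
  by case: (J0 w) => /=; rewrite ?mul1r ?mul0r ?mulr0 ?addr0 ?add0r.
move=> /(ae_le_expect (bounded_measurable_norm blhs) brhs).
move=> /(le_trans (expect_norm_le P blhs)).
have -> : \int[P]_w lhs w = - (drift_term h + p a * jump_term
     + p (b true) * switch_term true + p (b false) * switch_term false).
  rewrite /lhs expectB; last 2 first.
  - exact: bounded_measurableB.
  - by apply: bounded_measurableD; [apply: bounded_measurableD|apply: bounded_measurableD];
      rewrite //; apply: bM.
  rewrite expectB// stat subrr sub0r; congr (- _).
  rewrite expectD; last 2 first.
  - by apply: bounded_measurableD => //; apply: bM.
  - by apply: bounded_measurableD; apply: bM.
  rewrite (expectD _ bDw (bM _ _ ma bSw)).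
  rewrite (expectD _ (bM _ _ (mb true) (bWw true)) (bM _ _ (mb false) (bWw false))).
  by rewrite Ea !Eb addrA.
rewrite normrN => /le_trans; apply; rewrite le_eqVlt; apply/orP; left; apply/eqP.
rewrite /rhs expectZl; last first.
  do 4 (apply: bounded_measurableD; last by apply: bM => //; exact: bbool).
  apply: bounded_measurableM; first exact: bounded_measurable_cst.
  by do 2 (apply: bounded_measurableD; last exact: bbool); exact: bbool.
congr (_ * _).
have bh3 : bounded_measurable (fun w => (a w)%:R + (b true w)%:R + (b false w)%:R : R).
  by do 2 (apply: bounded_measurableD; last exact: bbool); exact: bbool.
have bh4 : bounded_measurable (fun w => h * ((a w)%:R + (b true w)%:R + (b false w)%:R) : R).
  by apply: bounded_measurableM => //; exact: bounded_measurable_cst.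
have bab (e e' : T -> bool) : measurable_fun [set: T] e -> measurable_fun [set: T] e' ->
    bounded_measurable (fun w => (e w)%:R * (e' w)%:R : R).
  by move=> me me'; apply: bM => //; exact: bbool.
rewrite expectD; [|by do 3 (apply: bounded_measurableD; last exact: bab)|exact: bab].
rewrite expectD; [|by do 2 (apply: bounded_measurableD; last exact: bab)|exact: bab].
rewrite expectD; [|by do 1 (apply: bounded_measurableD; last exact: bab)|exact: bab].
rewrite expectD; [| |exact: bab] => //.
rewrite expectZl// expectD; [| |exact: bbool]; last by apply: bounded_measurableD; exact: bbool.
by rewrite expectD; [|exact: bbool|exact: bbool]; rewrite !E2.
Qed.

End one_step.

(** * The limit of short intervals *)

Section generator.
Context {R : realType}.
Variables (f : bool -> R -> R) (K L : R).
Hypothesis fK : forall j v, `|f j v| <= K.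
Hypothesis fL : forall j x y, `|f j x - f j y| <= L * `|x - y|.
Hypothesis mf : forall j, measurable_fun [set: R] (f j).
Variable df : R -> R.
Hypothesis dfE : forall v : R, 0 < v -> is_derive v 1 (f true) (df v).
Hypothesis bdf : bounded_measurable df.
Context {d : measure_display} {T : measurableType d} (P : probability T R).
Variables (V0 S : T -> R) (J0 : T -> bool).
Hypothesis mV0 : measurable_fun [set: T] V0.
Hypothesis mJ0 : measurable_fun [set: T] J0.
Hypothesis V0_ge0 : {ae P, forall w, 0 <= V0 w}.

(** The drift moves the workload down, so difference quotients are taken along negative
    increments. *)
Lemma cvg_harmonicN_dnbhs0 : - (@harmonic R n) @[n --> \oo] --> (0 : R)^'.
Proof.
move=> A [e /= e0 eA].
have := @cvg_harmonic R => /cvgrPdist_lt/(_ _ e0); apply: filterS => n; rewrite sub0r => hn.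
apply: eA; last by rewrite /= oppr_eq0 invr_eq0 pnatr_eq0.
by move: hn; rewrite /ball_ /= sub0r opprK normrN.
Qed.

(** At an empty queue the quotient is identically 0, so a derivative is needed at positive workloads
    only; this is where the indicator of [0 < V0 w] comes from. *)
Lemma drift_quotient_cvg (w : T) : 0 <= V0 w ->
  (harmonic n)^-1 * (f (J0 w) (drift (harmonic n) (J0 w) (V0 w)) - f (J0 w) (V0 w))
    @[n --> \oo] --> - ((J0 w && (0 < V0 w))%:R * df (V0 w)).
Proof.
move=> v0; case: (J0 w) => /=; last first.
  rewrite mul0r oppr0 (_ : (fun _ => _) = cst 0); first exact: cvg_cst.
  by apply/funext => n /=; rewrite subrr mulr0.
have [vpos|v_le0] := ltP 0 (V0 w); last first.
  have -> : V0 w = 0 by apply/eqP; rewrite eq_le v0 v_le0.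
  rewrite mul0r oppr0 (_ : (fun _ => _) = cst 0); first exact: cvg_cst.
  by apply/funext => n /=; rewrite max_r ?subrr ?mulr0//.
rewrite mul1r; set v := V0 w in vpos *.
have [der dE] := dfE vpos.
have : h^-1 *: (f true (h *: 1 + v) - f true v) @[h --> 0^'] --> df v.
  by rewrite -dE; exact: der.
move=> /(cvg_comp _ _ cvg_harmonicN_dnbhs0) /cvgN.
apply: cvg_trans; apply: near_eq_cvg.
have : \forall n \near \oo, harmonic n < v.
  have := @cvg_harmonic R => /cvgrPdist_lt/(_ _ vpos); apply: filterS => n.
  by rewrite sub0r normrN ger0_norm ?harmonic_ge0.
apply: filterS => n hv.
rewrite /= max_l ?subr_ge0 ?ltW//.
transitivity (- ((- harmonic n)^-1 * (f true (- harmonic n * 1 + v) - f true v))).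
  by [].
by rewrite mulr1 invrN mulNr opprK [- _ + v]addrC.
Qed.

Lemma drift_term_cvg :
  (harmonic n)^-1 * drift_term f P V0 J0 (harmonic n) @[n --> \oo] -->
  - \int[P]_w ((J0 w && (0 < V0 w))%:R * df (V0 w)).
Proof.
have mX : measurable_fun [set: T] (fun w => (V0 w, J0 w)) by exact: measurable_fun_pair.
have bD h : bounded_measurable
    (fun w => f (J0 w) (drift h (J0 w) (V0 w)) - f (J0 w) (V0 w)).
  exact: (bounded_measurable_comp (bounded_measurable_drift fK mf h) mX).
have blim : bounded_measurable (fun w => (J0 w && (0 < V0 w))%:R * df (V0 w)).
  apply: bounded_measurableM; last exact: bounded_measurable_comp.
  apply: (bounded_measurable_bool (b := fun w => J0 w && (0 < V0 w))).
  by apply: measurable_and => //; exact: measurable_fun_ltr.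
rewrite -expectN//.
under eq_cvg do rewrite -expectZl//.
apply: (@dominated_expect _ _ _ _ _ _ L).
- by move=> n; apply: measurable_funM => //; case: (bD (harmonic n)).
- apply: filterS V0_ge0 => w v0 n.
  have h0 := @harmonic_gt0 R n.
  rewrite normrM normfV (ger0_norm (ltW h0)) mulrC ler_pdivrMr//.
  by rewrite (le_trans (fL _ _ _))// ler_wpM2l ?(lip_ge0 fL)// drift_dist// ltW.
- by apply: filterS V0_ge0 => w v0; exact: drift_quotient_cvg.
- by have [] := bounded_measurableN blim.
Qed.

Lemma one_sub_expRN (x : R) : 0 <= x -> x - x ^+ 2 <= 1 - expR (- x) <= x.
Proof.
move=> x0; apply/andP; split; last by have := expR_ge1Dx (- x); lra.
have x1 : 0 < 1 + x by lra.
have : expR (- x) <= (1 + x)^-1.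
  by rewrite expRN lef_pV2 ?posrE ?expR_gt0// expR_ge1Dx.
suff : (1 + x)^-1 <= 1 - x + x ^+ 2 by lra.
(* Used through [(1 - x + x ^+ 2) * (1 + x) = 1 + x ^+ 3]. *)
have x3 : 0 <= x ^+ 3 by rewrite exprn_ge0.
by rewrite -[leLHS]mul1r ler_pdivrMr//; lra.
Qed.

Definition clock (h r : R) := 1 - expR (- (r * h)).

(** Since [clock h r] equals [r * h] up to [(r * h) ^+ 2], the hypothesis is a first-order expansion
    with an error of order [h ^+ 2]. Divided by [h], it gives a second value for the limit of the
    drift quotient. *)
Lemma generator_eq (lambda : R) (c : bool -> R) : 0 <= lambda -> (forall j, 0 <= c j) ->
  (forall h, 0 < h ->
    `|drift_term f P V0 J0 h + clock h lambda * jump_term f P V0 S J0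
      + clock h (c true) * switch_term f P V0 J0 true
      + clock h (c false) * switch_term f P V0 J0 false| <=
    (8 * K + 2 * L) * (h * (clock h lambda + clock h (c true) + clock h (c false))
     + clock h lambda * clock h lambda + clock h lambda * clock h (c true)
     + clock h lambda * clock h (c false) + clock h (c true) * clock h (c false))) ->
  lambda * jump_term f P V0 S J0 + c true * switch_term f P V0 J0 true
  + c false * switch_term f P V0 J0 false =
  \int[P]_w ((J0 w && (0 < V0 w))%:R * df (V0 w)).
Proof.
move=> l0 c0 step.
set D := drift_term f P V0 J0 in step *.
set G := jump_term f P V0 S J0 in step *.
set H := switch_term f P V0 J0 in step *.
have C0 : 0 <= 8 * K + 2 * L.
  have := lip_ge0 fL; have := le_trans (normr_ge0 _) (fK true 0); lra.
(* The first summand is the assumed bound with each clock replaced by its rate times [h]; the second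
   pays for the same replacement in the three main terms. *)
pose M := (8 * K + 2 * L) * (lambda + c true + c false + lambda * lambda
  + lambda * c true + lambda * c false + c true * c false)
  + (lambda ^+ 2 * `|G| + c true ^+ 2 * `|H true| + c false ^+ 2 * `|H false|).
pose kappa := lambda * G + c true * H true + c false * H false.
have bound h : 0 < h -> `|h^-1 * D h + kappa| <= M * h.
  move=> h0; have {}step := step h h0; rewrite /clock in step.
  have p2 r : 0 <= r -> r * h - (r * h) ^+ 2 <= 1 - expR (- (r * h)) <= r * h.
    by move=> r0; apply: one_sub_expRN; rewrite mulr_ge0// ltW.
  have p0 r : 0 <= r -> 0 <= 1 - expR (- (r * h)).
    by move=> r0; rewrite subr_ge0 -expR0 ler_expR oppr_le0 mulr_ge0// ltW.
  have perr r g : 0 <= r ->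
      `|r * h * g - (1 - expR (- (r * h))) * g| <= r ^+ 2 * `|g| * h ^+ 2.
    move=> r0; rewrite -mulrBl normrM ger0_norm; last by have := p2 r r0; lra.
    rewrite [leRHS](_ : _ = (r * h) ^+ 2 * `|g|); last by ring.
    by rewrite ler_wpM2r//; have := p2 r r0; lra.
  rewrite -(ler_pM2l h0) -{1}(gtr0_norm h0) -normrM mulrDr mulVKf ?gt_eqF//.
  set pl := 1 - expR (- (lambda * h)) in step.
  set pt := 1 - expR (- (c true * h)) in step.
  set pf := 1 - expR (- (c false * h)) in step.
  have -> : D h + h * kappa = (D h + pl * G + pt * H true + pf * H false)
     + (lambda * h * G - pl * G) + (c true * h * H true - pt * H true)
     + (c false * h * H false - pf * H false) by rewrite /kappa; ring.
  have -> : h * (M * h) = (8 * K + 2 * L) * (h * (lambda * h + c true * h + c false * h)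
      + (lambda * h) * (lambda * h) + (lambda * h) * (c true * h)
      + (lambda * h) * (c false * h) + (c true * h) * (c false * h))
      + lambda ^+ 2 * `|G| * h ^+ 2 + c true ^+ 2 * `|H true| * h ^+ 2
      + c false ^+ 2 * `|H false| * h ^+ 2 by rewrite /M; ring.
  do 3 (apply: le_trans (ler_normD _ _) _; apply: lerD; last exact: perr).
  apply: le_trans step _; apply: ler_wpM2l => //.
  have /andP[_ ul] := p2 _ l0; have /andP[_ ut] := p2 _ (c0 true).
  have /andP[_ uf] := p2 _ (c0 false).
  have := p0 _ l0; have := p0 _ (c0 true); have := p0 _ (c0 false).
  rewrite -/pl -/pt -/pf => pf0 pt0 pl0.
  by repeat apply: lerD; [rewrite ler_pM2l// !lerD|exact: ler_pM..].
have lim1 : (harmonic n)^-1 * D (harmonic n) @[n --> \oo] --> - kappa.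
  apply/cvgrPdist_le => e e0.
  have : M * harmonic n @[n --> \oo] --> M * 0 by apply: cvgMr; exact: cvg_harmonic.
  rewrite mulr0 => /cvgrPdist_le /(_ e e0); apply: filterS => n.
  rewrite sub0r normrN => hn; rewrite -opprD normrN addrC.
  by rewrite (le_trans (bound _ (harmonic_gt0 n)))// (le_trans (ler_norm _)).
apply: oppr_inj; rewrite -/kappa.
exact: (cvg_unique _ lim1 drift_term_cvg).
Qed.

End generator.

(** * Paths of the workload *)

(* The set of busy times in [workload_path] need not be measurable, so its
   "length" is only the lower integral of its indicator; monotonicity survives. *)
Lemma ge0_le_lower_integral {R : realType} {d : measure_display}
    {T : measurableType d} (m : {measure set T -> \bar R}) (D : set T)
    (f g : T -> \bar R) : (forall x, D x -> 0 <= f x)%E ->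
  (forall x, D x -> f x <= g x)%E ->
  (\int[m]_(x in D) f x <= \int[m]_(x in D) g x)%E.
Proof.
move=> f0 fg; have g0 x (Dx : D x) : (0 <= g x)%E := le_trans (f0 x Dx) (fg x Dx).
rewrite !ge0_integralE//; apply: le_ereal_sup => /= _ [h hf <-].
by exists h => // x; apply: le_trans (hf x) _; exact: lee_restrict.
Qed.

Section workload_path.
Context {R : realType}.
Variables (inter serv : nat -> R) (present : R -> bool) (v : R -> R).
Hypothesis path : workload_path inter serv present v.
Local Notation mu := (@lebesgue_measure R).

Let busy (t : R) :=
  (\int[mu]_(u in `[0%R, t]) ((present u && (0 < v u)%R)%:R)%:E)%E.

Let busy_ge0 t : (0 <= busy t)%E.
Proof. by apply: integral_ge0 => u _; rewrite lee_fin. Qed.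

Let busy_le t : 0 <= t -> (busy t <= t%:E)%E.
Proof.
move=> t0; apply: (@le_trans _ _ (\int[mu]_(u in `[0%R, t]) (cst 1) u)%E).
  by apply: ge0_le_lower_integral => u _; rewrite lee_fin//; case: (_ && _).
rewrite integral_cst// mul1e [leLHS]lebesgue_measure_itv/= lte_fin.
by case: ifPn => //; rewrite EFinN sube0.
Qed.

(** The indicator of [[0, s[] is measurable and lies below that of the busy times, so its integral
    is a lower bound even for a lower integral. *)
Let le_busy s t : 0 <= s -> s <= t ->
  (forall u, 0 <= u < s -> present u /\ 0 < v u) -> (s%:E <= busy t)%E.
Proof.
move=> s0 st pos.
apply: (@le_trans _ _ (\int[mu]_(u in `[0%R, t]) (\1_`[0%R, s[ u)%:E)%E).
  rewrite integral_indic// (_ : _ `&` _ = `[0%R, s[%classic).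
    rewrite [leRHS]lebesgue_measure_itv/= lte_fin.
    by case: ifPn; rewrite ?EFinN ?sube0// -leNgt lee_fin.
  rewrite setIidl// => u /=; rewrite !in_itv/= => /andP[-> us].
  by rewrite (le_trans (ltW us)).
apply: ge0_le_lower_integral => u _; rewrite lee_fin// indicE.
have [|//] := boolP (u \in _); rewrite inE/= in_itv/= => /pos[-> ->] //.
Qed.

Let busy_fin t : 0 <= t -> busy t = (fine (busy t))%:E.
Proof.
move=> t0; rewrite fineK// ge0_fin_numE//.
by apply: le_lt_trans (busy_le t0) _; exact: ltry.
Qed.

Lemma workload_ge0 t : 0 <= t -> 0 <= v t.
Proof. by move=> /path[]. Qed.

Let balance t x : 0 <= t ->
  (\sum_(0 <= n <oo | (arrival_epoch inter n <= t)%R) (serv n)%:E = x%:E)%E ->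
  v t + fine (busy t) = v 0 + x.
Proof.
move=> t0 xE; have [_] := path t0; rewrite xE -/(busy t) busy_fin//.
by case.
Qed.

Section no_arrival.
Variable h : R.
Hypothesis h_ge0 : 0 <= h.
Hypothesis no_arrival : forall n, h < arrival_epoch inter n.

Let balance0 t : 0 <= t <= h -> v t + fine (busy t) = v 0.
Proof.
move=> /andP[t0 th]; rewrite (@balance t 0) ?addr0//.
by apply: eseries_pred0 => n; apply/negbTE; rewrite -ltNge (le_lt_trans th).
Qed.

Lemma no_arrival_dist : `|v h - v 0| <= h.
Proof.
have := @balance0 h; rewrite lexx h_ge0 => /(_ isT) <-.
rewrite opprD addrA subrr sub0r normrN ger0_norm ?fine_ge0// -lee_fin -busy_fin//.
exact: busy_le.
Qed.

Lemma no_arrival_absent : (forall t, 0 <= t <= h -> ~~ present t) -> v h = v 0.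
Proof.
move=> abs; have := @balance0 h; rewrite lexx h_ge0 => /(_ isT) <-.
rewrite [X in fine X](_ : _ = 0%E) ?addr0//.
apply: integral0_eq => u /=; rewrite in_itv/= => /abs /negbTE -> //.
Qed.

(* A positive workload [x] stays positive on [0, x[, so that the server is
   busy for at least [min x h]. *)
Lemma no_arrival_drift : (forall t, 0 <= t <= h -> present t) ->
  v h = Num.max (v 0 - h) 0.
Proof.
move=> pres; have v0 := workload_ge0 (lexx 0).
have vh0 := workload_ge0 h_ge0.
have pos u : 0 <= u <= h -> u < v 0 -> present u /\ 0 < v u.
  move=> uh uv; split; first exact: pres.
  have /andP[u0 _] := uh.
  have := balance0 uh; have := busy_le u0; rewrite busy_fin// lee_fin.
  by move=> ? ?; lra.
have bh := @balance0 h; rewrite lexx h_ge0 in bh; have {}bh := bh isT.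
have := busy_le h_ge0; rewrite busy_fin// lee_fin => busyh.
have [le_hv|lt_vh] := leP h (v 0).
  rewrite max_l ?subr_ge0//.
  have : (h%:E <= busy h)%E.
    by apply: le_busy => // u /andP[u0 uh]; apply: pos; rewrite ?u0 ?ltW//; lra.
  by rewrite busy_fin// lee_fin => ?; lra.
rewrite max_r ?subr_le0 ?ltW//.
have : ((v 0)%:E <= busy h)%E.
  by apply: le_busy => [|| u /andP[u0 uv]]; [|exact: ltW|apply: pos; rewrite ?u0 /=; lra].
by rewrite busy_fin// lee_fin => ?; lra.
Qed.

End no_arrival.

Lemma one_arrival_dist h : arrival_epoch inter 0 <= h -> 0 <= h ->
  (forall n, h < arrival_epoch inter n.+1) -> `|v h - (v 0 + serv 0)| <= h.
Proof.
move=> a0 h0 a1; rewrite -(balance h0 (x := serv 0)).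
  rewrite opprD addrA subrr sub0r normrN ger0_norm ?fine_ge0// -lee_fin -busy_fin//.
  exact: busy_le.
(* Only arrival 0 has taken place, so the partial sums are constant from index 1 on. *)
apply: lim_near_cst => //; exists 1%N => // -[//|n] _ /=.
rewrite big_ltn_cond// a0 big_nat_cond big1 ?adde0// => -[//|k].
by rewrite leNgt a1/= andbF.
Qed.

End workload_path.

(** * Exponential clocks *)

Section exponential.
Context {R : realType} {d : measure_display} {T : measurableType d}.
Variables (P : probability T R) (X : T -> R) (r : R).
Hypothesis r_gt0 : 0 < r.
Hypothesis Xexp : has_law P X (exponential_prob r).

Lemma exponential_ge0 : {ae P, forall w, 0 <= X w}.
Proof.
have [mX lX] := Xexp.
have mN : measurable (`]-oo, 0[%classic : set R) by exact: measurable_itv.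
exists (X @^-1` (`]-oo, 0[%classic)); split.
- by rewrite -[_ @^-1` _]setTI; exact: mX.
- rewrite lX//; apply: integral0_eq => x /=; rewrite in_itv/= => x0.
  by rewrite lt0_exponential_pdf.
- by move=> w /negP; rewrite /= in_itv/= -ltNge.
Qed.

Lemma exponential_le (h : R) : 0 < h -> P [set w | X w <= h] = (1 - expR (- (r * h)))%:E.
Proof.
move=> h0; have [mX lX] := Xexp.
have -> : [set w | X w <= h] = X @^-1` (`]-oo, h]%classic).
  by apply/seteqP; split=> w /=; rewrite in_itv.
rewrite lX//.
have -> : (`]-oo, h]%classic : set R) = `]-oo, 0[%classic `|` `[0, h]%classic.
  apply/seteqP; split => x /=; rewrite !in_itv/=.
    by move=> xh; case: (ltP x 0) => x0; [left|right; rewrite xh].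
  by case=> [x0|/andP[]//]; rewrite ltW// (lt_trans x0).
rewrite /exponential_prob ge0_integral_setU//=.
- rewrite [X in (X + _)%E]integral0_eq ?add0e.
    by rewrite -/(exponential_prob r _) exponential_prob_itv0c// mulNr -EFinB.
  by move=> x /=; rewrite in_itv/= => x0; rewrite lt0_exponential_pdf.
- by apply/measurable_EFinP/measurable_funTS; exact: measurable_exponential_pdf.
- by move=> x _; rewrite lee_fin exponential_pdf_ge0// ltW.
- apply/disj_setPS => x [] /=; rewrite !in_itv/= => x0 /andP[].
  by rewrite leNgt x0.
Qed.

Lemma mass_exponential (h : R) : 0 < h -> mass P (fun w => X w <= h) = clock h r.
Proof.
move=> h0; rewrite /mass (@expect_bool _ _ _ _ _ [set w | X w <= h])//.
  by rewrite exponential_le.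
have [mX _] := Xexp.
have -> : [set w | X w <= h] = X @^-1` (`]-oo, h]%classic).
  by apply/seteqP; split=> w /=; rewrite in_itv.
by rewrite -[_ @^-1` _]setTI; apply: mX => //; exact: measurable_itv.
Qed.

End exponential.

(** * Generator equations of the two queues *)

Section generated.
Context {R : realType} {d : measure_display} {T : measurableType d}.
Variables (P : probability T R) (I : Type) (F : I -> set_system T).
Hypothesis indep : mutually_independent P F.
Context {d1 d2 d3 : measure_display} {T1 : measurableType d1}
  {T2 : measurableType d2} {T3 : measurableType d3}.

Lemma generated_preimage (X : T -> T1) (A : set T1) : measurable A ->
  generated X (X @^-1` A).
Proof. by move=> mA; exists A => //; rewrite setTI. Qed.

Lemma generated_comp (X : T -> T1) (g : T1 -> T2) (A : set T2) :
  measurable_fun [set: T1] g -> measurable A -> generated X ((g \o X) @^-1` A).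
Proof.
move=> mg mA; rewrite comp_preimage; apply: generated_preimage.
by rewrite -[_ @^-1` _]setTI; exact: mg.
Qed.

Lemma independent_pair_cst (X : T -> T1) (y : T2) : independent_pair P X (fun=> y).
Proof.
move=> A C mA mC; rewrite preimage_cst; case: ifPn => _.
  by rewrite setIT probability_setT mule1.
by rewrite setI0 measure0 mule0.
Qed.

Lemma mutually_independent_pair (i j : I) (X : T -> T1) (Y : T -> T2) :
  i <> j -> (forall A, measurable A -> F i (X @^-1` A)) ->
  (forall A, measurable A -> F j (Y @^-1` A)) -> independent_pair P X Y.
Proof.
by move=> ij FX FY A B mA mB; apply: (mutually_independent2 indep ij);
  [exact: FX|exact: FY].
Qed.

Lemma mutually_independent_triple (i j k : I) (X : T -> T1) (Y : T -> T2) (Z : T -> T3) :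
  i <> j -> i <> k -> j <> k ->
  measurable_fun [set: T] X -> measurable_fun [set: T] Y -> measurable_fun [set: T] Z ->
  (forall A, measurable A -> F i (X @^-1` A)) ->
  (forall A, measurable A -> F j (Y @^-1` A)) ->
  (forall A, measurable A -> F k (Z @^-1` A)) ->
  independent_pair P (fun w => (X w, Y w)) Z.
Proof.
move=> ij ik jk mX mY mZ FX FY FZ; apply: independent_pair_triple => //.
by move=> A B C mA mB mC; apply: (mutually_independent3 indep ij ik jk);
  [exact: FX|exact: FY|exact: FZ].
Qed.

End generated.

Lemma arrival_epoch_ge {R : realType} (inter : nat -> R) n :
  (forall k, 0 <= inter k) -> inter 0%N <= arrival_epoch inter n.
Proof.
by move=> ge0; rewrite /arrival_epoch big_ord_recl lerDl sumr_ge0.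
Qed.

(** Two arrivals in [[0, h]] thus force the second interarrival time to be at most [h], an event
    that, unlike the second epoch itself, is independent of the first interarrival time. *)
Lemma arrival_epochS_ge {R : realType} (inter : nat -> R) n :
  (forall k, 0 <= inter k) -> inter 1%N <= arrival_epoch inter n.+1.
Proof.
move=> ge0; rewrite /arrival_epoch 2!big_ord_recl addrCA lerDl addr_ge0//.
by rewrite sumr_ge0.
Qed.

Lemma measurable_le_cst {R : realType} (h : R) :
  measurable_fun [set: R] (fun x : R => x <= h).
Proof. exact: measurable_fun_ler. Qed.

Section polling_generator.
Context {R : realType}.
Variables (f : bool -> R -> R) (K L : R).
Hypothesis fK : forall j v, `|f j v| <= K.
Hypothesis fL : forall j x y, `|f j x - f j y| <= L * `|x - y|.
Hypothesis mf : forall j, measurable_fun [set: R] (f j).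
Variable df : R -> R.
Hypothesis dfE : forall v : R, 0 < v -> is_derive v 1 (f true) (df v).
Hypothesis bdf : bounded_measurable df.
Context {d : measure_display} {T : measurableType d} (P : probability T R).

Section polling.
Variables (lambda c : queue -> R) (B : queue -> probability R R).
Variables (inter serv resid : queue -> nat -> T -> R).
Variables (V : queue -> R -> T -> R) (J : R -> T -> queue).
Variable pst : probability (R * R * queue)%type R.
Hypothesis lambda_gt0 : forall i, 0 < lambda i.
Hypothesis c_gt0 : forall i, 0 < c i.
Hypothesis process : polling_process P lambda c B inter serv resid V J.
Hypothesis stationary : forall t : R, 0 <= t -> has_law P (polling_state V J t) pst.

Lemma polling_workload1_ge0 : {ae P, forall w, 0 <= V queue1 0 w}.
Proof. by apply: filterS (polling_workload process queue1) => w /workload_ge0; exact. Qed.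

(** The clauses are the pathwise input of [one_step_expect]. Almost surely the interarrival and
    residing times involved are nonnegative, so the first two interarrival times and the first
    residing time at each queue decide which clause applies. *)
Lemma polling_path (h : R) : 0 < h -> {ae P, forall w, [/\ 0 <= V queue1 0 w,
    ~~ (inter queue1 0 w <= h) -> ~~ (resid (J 0 w) 0 w <= h) ->
      J h w = J 0 w /\ V queue1 h w = drift h (J 0 w) (V queue1 0 w),
    inter queue1 0 w <= h -> ~~ (inter queue1 1 w <= h) -> ~~ (resid (J 0 w) 0 w <= h) ->
      J h w = J 0 w /\ `|V queue1 h w - (V queue1 0 w + serv queue1 0 w)| <= h &
    ~~ (inter queue1 0 w <= h) -> resid (J 0 w) 0 w <= h -> ~~ (resid (~~ J 0 w) 0 w <= h) ->
      J h w = ~~ J 0 w /\ `|V queue1 h w - V queue1 0 w| <= h]}.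
Proof.
move=> h0.
have inter_ge0 : {ae P, forall w, forall n, 0 <= inter queue1 n w}.
  by apply/ae_foralln => n; apply: exponential_ge0 (polling_interarrival_law process _ _).
have residt_ge0 := exponential_ge0 (polling_residing_law process true 0).
have residf_ge0 := exponential_ge0 (polling_residing_law process false 0).
have work := polling_workload process queue1.
have server := polling_server process.
apply: filterS3 inter_ge0 (filterI residt_ge0 residf_ge0) (filterI work server).
move=> w inter0 [rt0 rf0] [pw sw].
have hge0 := ltW h0.
have r0 j : 0 <= resid j 0 w by case: j.
have epoch0 : switch_epoch (fun i n => resid i n w) (J 0 w) 0 = 0.
  by rewrite /switch_epoch big_ord0.
have epoch1 : switch_epoch (fun i n => resid i n w) (J 0 w) 1 = resid (J 0 w) 0 w.
  by rewrite /switch_epoch big_ord1.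
(* The first two periods are each the first visit to their queue, since [0./2] and [1./2] are both
   0. *)
have epoch2 : switch_epoch (fun i n => resid i n w) (J 0 w) 2 =
    resid (J 0 w) 0 w + resid (~~ J 0 w) 0 w.
  by rewrite /switch_epoch !big_ord_recl big_ord0 addr0.
have stay : ~~ (resid (J 0 w) 0 w <= h) -> forall t, 0 <= t <= h -> J t w = J 0 w.
  rewrite -ltNge => rh t /andP[t0 th].
  have -> // := sw t 0%N _.
  by rewrite epoch0 epoch1 t0 (le_lt_trans th).
have none : ~~ (inter queue1 0 w <= h) ->
    forall n, h < arrival_epoch (fun n => inter queue1 n w) n.
  rewrite -ltNge => ah n; apply: lt_le_trans ah _.
  exact: (arrival_epoch_ge (inter := fun n => inter queue1 n w)).
split.
- exact: workload_ge0 pw _ _.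
- move=> ah /stay Jh; split; first by rewrite Jh// hge0 lexx.
  rewrite /drift; case: ifPn => J0.
    apply: (no_arrival_drift pw hge0 (none ah)) => t /Jh ->.
    by rewrite J0.
  apply: (no_arrival_absent pw hge0 (none ah)) => t /Jh ->.
  by rewrite (negbTE J0).
- move=> ah; rewrite -ltNge => a2h /stay Jh; split; first by rewrite Jh// hge0 lexx.
  apply: (one_arrival_dist pw) => //; first by rewrite /arrival_epoch big_ord1.
  move=> n; apply: lt_le_trans a2h _.
  exact: (arrival_epochS_ge (inter := fun n => inter queue1 n w)).
- move=> ah rh; rewrite -ltNge => r2h; split; last first.
    exact: (no_arrival_dist pw hge0 (none ah)).
  (* Time [h] falls in period number 1: the first period is over, and the second alone is longer
     than [h]. *)
  have -> // := sw h 1%N _.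
  by rewrite epoch1 epoch2 rh (lt_le_trans r2h)// lerDr.
Qed.

Lemma polling_measurable (t : R) : 0 <= t ->
  measurable_fun [set: T] (V queue1 t) /\ measurable_fun [set: T] (J t).
Proof.
move=> t0; have [mX _] := stationary t0; split.
  exact: (measurableT_comp measurable_fst (measurableT_comp measurable_fst mX)).
exact: (measurableT_comp measurable_snd mX).
Qed.

(** The workload of queue 2 is forgotten: it influences neither the server position nor queue 1. *)
Let state : R * R * queue -> R * queue := fun x => (x.1.1, x.2).

Let measurable_state : measurable_fun [set: R * R * queue] state.
Proof.
by apply: measurable_fun_pair => //; exact: measurableT_comp.
Qed.

Lemma polling_initial_serv_independent :
  independent_pair P (fun w => (V queue1 0 w, J 0 w)) (serv queue1 0).
Proof.
apply: (mutually_independent_pair (polling_independent process)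
  (i := InitialState) (j := Service queue1 0)) => // A mA.
- exact: (generated_comp (polling_state V J 0) measurable_state).
- exact: generated_preimage.
Qed.

Lemma polling_generator :
  lambda queue1 * jump_term f P (V queue1 0) (serv queue1 0) (J 0)
  + c queue1 * switch_term f P (V queue1 0) (J 0) queue1
  + c queue2 * switch_term f P (V queue1 0) (J 0) queue2 =
  \int[P]_w ((J 0 w && (0 < V queue1 0 w))%:R * df (V queue1 0 w)).
Proof.
have [mV0 mJ0] := polling_measurable (lexx 0).
have mS : measurable_fun [set: T] (serv queue1 0) by case: (polling_service_law process queue1 0).
have mA n : measurable_fun [set: T] (inter queue1 n).
  by case: (polling_interarrival_law process queue1 n).
have mT j : measurable_fun [set: T] (resid j 0).
  by case: (polling_residing_law process j 0).
have indep := polling_independent process.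
have mX : measurable_fun [set: T] (fun w => (V queue1 0 w, J 0 w)) by exact: measurable_fun_pair.
have gX A : measurable A -> polling_generated inter serv resid V J InitialState
    ((fun w => (V queue1 0 w, J 0 w)) @^-1` A).
  by move=> mA'; exact: (generated_comp (polling_state V J 0) measurable_state).
have gA n A : measurable A ->
    polling_generated inter serv resid V J (Interarrival queue1 n) (inter queue1 n @^-1` A).
  exact: generated_preimage.
have gT j A : measurable A ->
    polling_generated inter serv resid V J (Residing j 0) (resid j 0 @^-1` A).
  exact: generated_preimage.
apply: (generator_eq fK fL mf dfE bdf mV0 mJ0 polling_workload1_ge0).
- exact: ltW.
- by move=> j; exact: ltW.
move=> h h0; have [mVh mJh] := polling_measurable (ltW h0).
have := one_step_expect fL fK mf mV0 mS mJ0 (ltW h0) mVh mJh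
  (measurableT_comp (measurable_le_cst h) (mA 0%N))
  (measurableT_comp (measurable_le_cst h) (mA 1%N))
  (b := fun j w => resid j 0 w <= h)
  (fun j => measurableT_comp (measurable_le_cst h) (mT j)) (polling_path h0).
rewrite !(mass_exponential (lambda_gt0 _) (polling_interarrival_law process _ _))//.
rewrite !(mass_exponential (c_gt0 _) (polling_residing_law process _ _))//.
apply.
(* Stationarity: at both times the expectation is the same integral against [pst]. *)
- have law t (t0 : 0 <= t) := expect_has_law (stationary t0)
    (bounded_measurable_comp (bounded_measurable_state fK mf) measurable_state).
  by rewrite /= in law; rewrite (law h (ltW h0)) (law 0 (lexx 0)).
- apply: (independent_pair_comp (measurable_le_cst h)).
  apply: (mutually_independent_triple indep (i := InitialState) (j := Service queue1 0)
    (k := Interarrival queue1 0)) => //; first exact: generated_preimage.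
  exact: gA.
- move=> j; apply: (independent_pair_comp (measurable_le_cst h)).
  apply: (mutually_independent_pair indep (i := InitialState) (j := Residing j 0)) => //.
  exact: gT.
- apply: (independent_pair_comp (measurable_le_cst h)); apply: independent_pairC.
  apply: (independent_pair_comp (measurable_le_cst h)); apply: independent_pairC.
  apply: (mutually_independent_pair indep (i := Interarrival queue1 0)
    (j := Interarrival queue1 1)) => //; exact: gA.
- move=> j; apply: (independent_pair_comp (measurable_le_cst h)); apply: independent_pairC.
  apply: (independent_pair_comp (measurable_le_cst h)); apply: independent_pairC.
  apply: (mutually_independent_pair indep (i := Interarrival queue1 0)
    (j := Residing j 0)) => //; [exact: gA|exact: gT].
- apply: (independent_pair_comp (measurable_le_cst h)); apply: independent_pairC.
  apply: (independent_pair_comp (measurable_le_cst h)); apply: independent_pairC.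
  apply: (mutually_independent_pair indep (i := Residing true 0)
    (j := Residing false 0)) => //; exact: gT.
Qed.

End polling.

Section mg1.
Variables (lambda : R) (B : probability R R).
Variables (inter serv : nat -> T -> R) (W : R -> T -> R).
Variable mu : probability R R.
Hypothesis lambda_gt0 : 0 < lambda.
Hypothesis process : mg1_process P lambda B inter serv W.
Hypothesis stationary : forall t : R, 0 <= t -> has_law P (W t) mu.

(** The M/G/1 queue is treated as a polling queue whose server never leaves, with switching clocks
    that never ring. *)
Let J0 (w : T) := true.

Lemma mg1_workload_ge0 : {ae P, forall w, 0 <= W 0 w}.
Proof. by apply: filterS (mg1_workload process) => w /workload_ge0; exact. Qed.

Lemma mg1_path (h : R) : 0 < h -> {ae P, forall w, [/\ 0 <= W 0 w,
    ~~ (inter 0%N w <= h) -> ~~ false -> J0 w = J0 w /\ W h w = drift h (J0 w) (W 0 w),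
    inter 0%N w <= h -> ~~ (inter 1%N w <= h) -> ~~ false ->
      J0 w = J0 w /\ `|W h w - (W 0 w + serv 0%N w)| <= h &
    ~~ (inter 0%N w <= h) -> false -> ~~ false ->
      J0 w = ~~ J0 w /\ `|W h w - W 0 w| <= h]}.
Proof.
move=> h0.
have inter_ge0 : {ae P, forall w, forall n, 0 <= inter n w}.
  by apply/ae_foralln => n; apply: exponential_ge0 (mg1_interarrival_law process _).
apply: filterS2 inter_ge0 (mg1_workload process) => w inter0 pw.
have hge0 := ltW h0; split => //.
- exact: workload_ge0 pw _ _.
- rewrite -ltNge => ah _; split=> //.
  apply: (no_arrival_drift pw hge0) => // n; apply: lt_le_trans ah _.
  exact: (arrival_epoch_ge (inter := fun n => inter n w)).
- move=> ah; rewrite -ltNge => a2h _; split=> //.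
  apply: (one_arrival_dist pw) => //; first by rewrite /arrival_epoch big_ord1.
  move=> n; apply: lt_le_trans a2h _.
  exact: (arrival_epochS_ge (inter := fun n => inter n w)).
Qed.

Lemma mg1_initial_serv_independent :
  independent_pair P (fun w => (W 0 w, J0 w)) (serv 0%N).
Proof.
apply: (mutually_independent_pair (mg1_independent process)
  (i := Mg1Initial) (j := Mg1Service 0)) => // A mA.
- exact: (generated_comp (W 0) (measurable_fun_pair (@measurable_id _ _ setT)
    (measurable_cst true))).
- exact: generated_preimage.
Qed.

Lemma mg1_generator :
  lambda * jump_term f P (W 0) (serv 0%N) J0 =
  \int[P]_w ((J0 w && (0 < W 0 w))%:R * df (W 0 w)).
Proof.
have mW t : 0 <= t -> measurable_fun [set: T] (W t) by move=> /stationary[].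
have mS : measurable_fun [set: T] (serv 0%N) by case: (mg1_service_law process 0).
have mA n : measurable_fun [set: T] (inter n) by case: (mg1_interarrival_law process n).
have indep := mg1_independent process.
have mJ0 : measurable_fun [set: T] J0 by exact: measurable_cst.
have mW0 := mW 0 (lexx 0).
have mX : measurable_fun [set: T] (fun w => (W 0 w, J0 w)) by exact: measurable_fun_pair.
have mpair : measurable_fun [set: R] (fun x : R => (x, true)).
  exact: (measurable_fun_pair (@measurable_id _ _ setT) (measurable_cst true)).
have gX A : measurable A -> mg1_generated inter serv W Mg1Initial
    ((fun w => (W 0 w, J0 w)) @^-1` A).
  by move=> mA'; exact: (generated_comp (W 0) mpair).
have gA n A : measurable A ->
    mg1_generated inter serv W (Mg1Interarrival n) (inter n @^-1` A).
  exact: generated_preimage.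
have mass0 : mass P (fun=> false) = 0 by rewrite /mass Rintegral_cst// mul0r.
(* Switching terms with rate 0 are added so that [generator_eq] applies to this queue as well. *)
suff : lambda * jump_term f P (W 0) (serv 0%N) J0
  + 0 * switch_term f P (W 0) J0 true + 0 * switch_term f P (W 0) J0 false
  = \int[P]_w ((J0 w && (0 < W 0 w))%:R * df (W 0 w)) by rewrite !mul0r !addr0.
apply: (generator_eq (c := fun=> 0) fK fL mf dfE bdf mW0 mJ0 mg1_workload_ge0) => //.
  exact: ltW.
move=> h h0.
have := one_step_expect fL fK mf mW0 mS mJ0 (ltW h0) (mW h (ltW h0)) mJ0
  (measurableT_comp (measurable_le_cst h) (mA 0%N))
  (measurableT_comp (measurable_le_cst h) (mA 1%N))
  (b := fun=> fun=> false)
  (fun j => measurable_cst false) (mg1_path h0).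
rewrite !(mass_exponential lambda_gt0 (mg1_interarrival_law process _))// mass0.
have -> : clock h 0 = 0 :> R by rewrite /clock mul0r oppr0 expR0 subrr.
apply.
- have law t (t0 : 0 <= t) := expect_has_law (stationary t0)
    (bounded_measurable_comp (bounded_measurable_state fK mf) mpair).
  by rewrite /= in law; rewrite (law h (ltW h0)) (law 0 (lexx 0)).
- apply: (independent_pair_comp (measurable_le_cst h)).
  apply: (mutually_independent_triple indep (i := Mg1Initial) (j := Mg1Service 0)
    (k := Mg1Interarrival 0)) => //; first exact: generated_preimage.
  exact: gA.
- by move=> j; exact: independent_pair_cst.
- apply: (independent_pair_comp (measurable_le_cst h)); apply: independent_pairC.
  apply: (independent_pair_comp (measurable_le_cst h)); apply: independent_pairC.
  apply: (mutually_independent_pair indep (i := Mg1Interarrival 0)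
    (j := Mg1Interarrival 1)) => //; exact: gA.
- by move=> j; exact: independent_pair_cst.
- exact: independent_pair_cst.
Qed.

End mg1.

End polling_generator.

(** * Damped trigonometric test functions *)

Section damped_trig.
Context {R : realType}.
Variables (a b al be : R).
Hypothesis a_ge0 : 0 <= a.

(** For [s = a + i b], [dcos a b v] is the real part of [e^(-s v)] and [dsin a b v] is the opposite
    of its imaginary part. *)
Definition dcos (a b v : R) := expR (- (a * v)) * cos (b * v).
Definition dsin (a b v : R) := expR (- (a * v)) * sin (b * v).

(** Together with [dsinD] this is [e^(-s (x + y)) = e^(-s x) e^(-s y)], which separates the workload
    from the service time at an arrival. *)
Lemma dcosD x y : dcos a b (x + y) = dcos a b x * dcos a b y - dsin a b x * dsin a b y.
Proof. by rewrite /dcos /dsin !mulrDr cosD opprD expRD; ring. Qed.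

Lemma dsinD x y : dsin a b (x + y) = dsin a b x * dcos a b y + dcos a b x * dsin a b y.
Proof. by rewrite /dcos /dsin !mulrDr sinD opprD expRD; ring. Qed.

Lemma dcos0 : dcos a b 0 = 1.
Proof. by rewrite /dcos !mulr0 oppr0 expR0 cos0 mulr1. Qed.

Lemma dsin0 : dsin a b 0 = 0.
Proof. by rewrite /dsin !mulr0 sin0 mulr0. Qed.

Lemma dcos_le1 v : 0 <= v -> `|dcos a b v| <= 1.
Proof.
move=> v0; rewrite normrM (ger0_norm (expR_ge0 _)).
by rewrite mulr_ile1 ?expR_ge0 ?normr_ge0 ?cos_max// -expR0 ler_expR oppr_le0 mulr_ge0.
Qed.

Lemma dsin_le1 v : 0 <= v -> `|dsin a b v| <= 1.
Proof.
move=> v0; rewrite normrM (ger0_norm (expR_ge0 _)).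
by rewrite mulr_ile1 ?expR_ge0 ?normr_ge0 ?sin_max// -expR0 ler_expR oppr_le0 mulr_ge0.
Qed.

Let is_derive_linear (k v : R) : is_derive v 1 (fun v => k * v) k.
Proof.
have := @is_deriveZ R R R id k v 1 1 (is_derive_id v 1).
by rewrite [k *: _]mulr1.
Qed.

Let is_derive_exp (v : R) :
  is_derive v 1 (fun v => expR (- (a * v))) (- a * expR (- (a * v))).
Proof.
have -> : (fun v => expR (- (a * v))) = expR \o (fun v => - a * v).
  by apply/funext => x /=; rewrite mulNr.
rewrite -mulNr [_ * expR _]mulrC.
by apply: (@is_derive1_comp _ expR (fun v => - a * v)); exact: is_derive_linear.
Qed.

Lemma is_derive_dcos (v : R) :
  is_derive v 1 (dcos a b) (- (a * dcos a b v + b * dsin a b v)).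
Proof.
have dc : is_derive v 1 (fun v => cos (b * v)) (- sin (b * v) * b).
  by apply: (@is_derive1_comp _ cos (fun v => b * v)); exact: is_derive_linear.
have de : is_derive v 1 (dcos a b) _ := is_deriveM (is_derive_exp v) dc.
apply: (is_derive_eq de).
by rewrite /GRing.scale/= /dcos /dsin; ring.
Qed.

Lemma is_derive_dsin (v : R) :
  is_derive v 1 (dsin a b) (b * dcos a b v - a * dsin a b v).
Proof.
have ds : is_derive v 1 (fun v => sin (b * v)) (cos (b * v) * b).
  by apply: (@is_derive1_comp _ sin (fun v => b * v)); exact: is_derive_linear.
have de : is_derive v 1 (dsin a b) _ := is_deriveM (is_derive_exp v) ds.
apply: (is_derive_eq de).
by rewrite /GRing.scale/= /dcos /dsin; ring.
Qed.

Lemma measurable_dcos : measurable_fun [set: R] (dcos a b).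
Proof.
apply: continuous_measurable_fun => v; apply/differentiable_continuous/derivable1_diffP.
by case: (is_derive_dcos v).
Qed.

Lemma measurable_dsin : measurable_fun [set: R] (dsin a b).
Proof.
apply: continuous_measurable_fun => v; apply/differentiable_continuous/derivable1_diffP.
by case: (is_derive_dsin v).
Qed.

(** The coefficients [(1, 0)] and [(0, 1)] give the two components of [e^(-s v)], so one computation
    serves both. *)
Definition trig (v : R) := al * dcos a b v + be * dsin a b v.
Definition dtrig (v : R) :=
  al * - (a * dcos a b v + b * dsin a b v) + be * (b * dcos a b v - a * dsin a b v).

Lemma is_derive_trig (v : R) : is_derive v 1 trig (dtrig v).
Proof.
rewrite (_ : trig = al \*: dcos a b + be \*: dsin a b)//.
exact: (is_deriveD (is_deriveZ al (is_derive_dcos v)) (is_deriveZ be (is_derive_dsin v))).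
Qed.

Lemma trig_bound v : 0 <= v -> `|trig v| <= `|al| + `|be|.
Proof.
move=> v0; rewrite (le_trans (ler_normD _ _))// [`|al * _|]normrM [`|be * _|]normrM.
by apply: lerD; rewrite ler_piMr ?dcos_le1 ?dsin_le1.
Qed.

Lemma dtrig_bound v : 0 <= v -> `|dtrig v| <= (`|al| + `|be|) * (a + `|b|).
Proof.
move=> v0; have C1 := dcos_le1 v0; have S1 := dsin_le1 v0.
have bound (x y : R) : `|x| <= 1 -> `|y| <= 1 -> `|a * x| + `|b * y| <= a + `|b|.
  by move=> x1 y1; rewrite !normrM (ger0_norm a_ge0); apply: lerD; rewrite ler_piMr.
rewrite (le_trans (ler_normD _ _))// [`|al * _|]normrM [`|be * _|]normrM normrN.
rewrite mulrDl; apply: lerD; apply: ler_wpM2l => //.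
  by rewrite (le_trans (ler_normD _ _))// bound.
by rewrite (le_trans (ler_normB _ _))// addrC bound.
Qed.

Lemma trig_lipschitz x y : 0 <= x -> 0 <= y ->
  `|trig x - trig y| <= (`|al| + `|be|) * (a + `|b|) * `|x - y|.
Proof.
wlog xy : x y / y <= x.
  move=> wl x0 y0; have [/wl->//|/ltW /wl yx] := leP y x.
  by rewrite distrC [`|x - y|]distrC yx.
move=> x0 y0; have [|z] := @MVT_segment R trig dtrig y x xy (fun z _ => is_derive_trig z).
  apply: continuous_subspaceT => z; apply/differentiable_continuous/derivable1_diffP.
  by case: (is_derive_trig z).
rewrite in_itv/= => /andP[yz _] ->; rewrite normrM ler_wpM2r//.
by rewrite dtrig_bound// (le_trans y0).
Qed.

(** The test function lives on the server position [i], so each position gets its own balance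
    equation. The truncation extends to all of [R] the bounds known on the half-line. *)
Definition trig_pos (i j : bool) (v : R) := (j == i)%:R * trig (Num.max v 0).
Definition dtrig_pos (i : bool) (v : R) := (true == i)%:R * dtrig (Num.max v 0).

Lemma trig_pos_bound i j v : `|trig_pos i j v| <= `|al| + `|be|.
Proof.
rewrite /trig_pos; case: eqP => _; first by rewrite mul1r trig_bound ?max0_ge0.
by rewrite mul0r normr0 addr_ge0.
Qed.

Lemma trig_pos_lipschitz i j x y :
  `|trig_pos i j x - trig_pos i j y| <= (`|al| + `|be|) * (a + `|b|) * `|x - y|.
Proof.
have C0 : 0 <= (`|al| + `|be|) * (a + `|b|) by rewrite mulr_ge0 ?addr_ge0.
rewrite /trig_pos; case: eqP => _; last by rewrite !mul0r subrr normr0 mulr_ge0.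
rewrite !mul1r (le_trans (trig_lipschitz (max0_ge0 x) (max0_ge0 y)))// ler_wpM2l//.
have h1 := ler_norm (x - y); have h2 : y - x <= `|x - y| by rewrite distrC ler_norm.
by case: (leP x 0); case: (leP y 0) => ? ? //; rewrite ler_norml; apply/andP; split; lra.
Qed.

Lemma measurable_trig : measurable_fun [set: R] trig.
Proof.
by apply: measurable_funD; apply: measurable_funM => //;
  [exact: measurable_dcos|exact: measurable_dsin].
Qed.

Lemma measurable_trig_pos i j : measurable_fun [set: R] (trig_pos i j).
Proof.
apply: measurable_funM => //; apply: (measurableT_comp measurable_trig).
exact: measurable_maxr.
Qed.

Lemma bounded_measurable_dtrig_pos i : bounded_measurable (dtrig_pos i).
Proof.
split.
  apply: measurable_funM => //.
  apply: (measurableT_comp (f := dtrig)); last exact: measurable_maxr.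
  have mc := measurable_dcos; have ms := measurable_dsin.
  apply: measurable_funD; apply: measurable_funM => //.
    apply: measurableT_comp => //.
    by apply: measurable_funD; exact: measurable_funM.
  by apply: measurable_funB; exact: measurable_funM.
exists ((`|al| + `|be|) * (a + `|b|)) => v; rewrite /dtrig_pos.
case: eqP => _; first by rewrite mul1r dtrig_bound ?max0_ge0.
by rewrite mul0r normr0 mulr_ge0 ?addr_ge0.
Qed.

(** The truncation may create a kink at 0, but near a positive [v] it changes nothing. *)
Lemma is_derive_trig_pos i (v : R) : 0 < v -> is_derive v 1 (trig_pos i true) (dtrig_pos i v).
Proof.
move=> v0; have vmax : Num.max v 0 = v by rewrite max_l// ltW.
have dtrigi : is_derive v 1 ((true == i)%:R \*: trig) (dtrig_pos i v).
  by rewrite /dtrig_pos vmax; exact: (is_deriveZ _ (is_derive_trig v)).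
apply: near_eq_is_derive dtrigi.
have : \forall x \near v, 0 < x by exact: lt_nbhsr.
by apply: filterS => x x0; rewrite /trig_pos [Num.max x 0]max_l// ltW.
Qed.

End damped_trig.

(** * Balance equations *)

Section balance.
Context {R : realType} {d : measure_display} {T : measurableType d}.
Variables (P : probability T R) (lambda : R) (c : bool -> R).
Variables (V0 S : T -> R) (J0 : T -> bool).

(** Common interface of the two models: the M/G/1 queue satisfies it with [c] zero and [J0]
    constantly [true], so the computations below serve both. *)
Definition generator_identity := forall (f : bool -> R -> R) (K L : R) (df : R -> R),
  (forall j v, `|f j v| <= K) ->
  (forall j x y, `|f j x - f j y| <= L * `|x - y|) ->
  (forall j, measurable_fun [set: R] (f j)) ->
  (forall v : R, 0 < v -> is_derive v 1 (f true) (df v)) ->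
  bounded_measurable df ->
  lambda * jump_term f P V0 S J0 + c true * switch_term f P V0 J0 true
  + c false * switch_term f P V0 J0 false =
  \int[P]_w ((J0 w && (0 < V0 w))%:R * df (V0 w)).

Hypothesis gen : generator_identity.
Hypothesis mV0 : measurable_fun [set: T] V0.
Hypothesis mS : measurable_fun [set: T] S.
Hypothesis mJ0 : measurable_fun [set: T] J0.
Hypothesis V0_ge0 : {ae P, forall w, 0 <= V0 w}.
Hypothesis S_ge0 : {ae P, forall w, 0 <= S w}.
Hypothesis indep : independent_pair P (fun w => (V0 w, J0 w)) S.
Variables (a b : R).
Hypothesis a_ge0 : 0 <= a.

(* The test functions are bounded on [0, oo[ only: negative workloads, which
   have probability zero, are sent to 0. *)
Definition pcos (v : R) := dcos a b (Num.max v 0).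
Definition psin (v : R) := dsin a b (Num.max v 0).

Lemma bounded_measurable_pcos : bounded_measurable pcos.
Proof.
split; last by exists 1 => v; by apply: dcos_le1 => //; exact: max0_ge0.
by apply: (measurableT_comp (measurable_dcos a b)); exact: measurable_maxr.
Qed.

Lemma bounded_measurable_psin : bounded_measurable psin.
Proof.
split; last by exists 1 => v; by apply: dsin_le1 => //; exact: max0_ge0.
by apply: (measurableT_comp (measurable_dsin a b)); exact: measurable_maxr.
Qed.

(** [cos_part i] and the opposite of [sin_part i] are the real and imaginary parts of [phi_i], with
    position [true] for queue 1. *)
Definition cos_part i := \int[P]_w ((J0 w == i)%:R * pcos (V0 w)).
Definition sin_part i := \int[P]_w ((J0 w == i)%:R * psin (V0 w)).
Definition idle_mass := \int[P]_w ((J0 w && ~~ (0 < V0 w))%:R : R).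

(** The generator identity is applied to [trig_pos i]. An arrival multiplies [e^(-s V0)] by an
    independent [e^(-s S)], a switch moves mass between the two positions, and the workload drains
    only at queue 1, whence the factor [(true == i)%:R]. *)
Lemma trig_balance (i : bool) (al be : R) :
  let bC := \int[P]_w pcos (S w) in
  let bS := \int[P]_w psin (S w) in
  lambda * (al * (cos_part i * bC - sin_part i * bS)
            + be * (sin_part i * bC + cos_part i * bS)
            - (al * cos_part i + be * sin_part i))
  - c i * (al * cos_part i + be * sin_part i)
  + c (~~ i) * (al * cos_part (~~ i) + be * sin_part (~~ i)) =
  (true == i)%:R * ((be * b - al * a) * (cos_part i - idle_mass)
                    - (al * b + be * a) * sin_part i).
Proof.
move=> bC bS.
have mX : measurable_fun [set: T] (fun w => (V0 w, J0 w)) by exact: measurable_fun_pair.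
have bi j : bounded_measurable (fun x : R * bool => (x.2 == j)%:R : R).
  exact: bounded_measurable_eqb measurable_snd.
have bXC j : bounded_measurable (fun x : R * bool => (x.2 == j)%:R * pcos x.1).
  apply: bounded_measurableM => //.
  exact: (bounded_measurable_comp bounded_measurable_pcos).
have bXS j : bounded_measurable (fun x : R * bool => (x.2 == j)%:R * psin x.1).
  apply: bounded_measurableM => //.
  exact: (bounded_measurable_comp bounded_measurable_psin).
pose C j w := (J0 w == j)%:R * pcos (V0 w).
pose D j w := (J0 w == j)%:R * psin (V0 w).
have bCw j : bounded_measurable (C j) := bounded_measurable_comp (bXC j) mX.
have bDw j : bounded_measurable (D j) := bounded_measurable_comp (bXS j) mX.
have bcS : bounded_measurable (fun w => pcos (S w)).
  exact: (bounded_measurable_comp bounded_measurable_pcos).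
have bsS : bounded_measurable (fun w => psin (S w)).
  exact: (bounded_measurable_comp bounded_measurable_psin).
have bc r : bounded_measurable (fun _ : T => r : R) by exact: bounded_measurable_cst.
have bl j : bounded_measurable (fun w => al * C j w + be * D j w).
  by apply: bounded_measurableD; apply: bounded_measurableM.
have El j : \int[P]_w (al * C j w + be * D j w) = al * cos_part j + be * sin_part j.
  by rewrite expectD ?expectZl//; apply: bounded_measurableM.
have ECC : \int[P]_w (C i w * pcos (S w)) = cos_part i * bC.
  exact: (independent_pair_expectM mX mS indep (bXC i) bounded_measurable_pcos).
have ECS : \int[P]_w (C i w * psin (S w)) = cos_part i * bS.
  exact: (independent_pair_expectM mX mS indep (bXC i) bounded_measurable_psin).
have ESC : \int[P]_w (D i w * pcos (S w)) = sin_part i * bC.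
  exact: (independent_pair_expectM mX mS indep (bXS i) bounded_measurable_pcos).
have ESS : \int[P]_w (D i w * psin (S w)) = sin_part i * bS.
  exact: (independent_pair_expectM mX mS indep (bXS i) bounded_measurable_psin).
have := gen (trig_pos_bound b al be a_ge0 i) (trig_pos_lipschitz b al be a_ge0 i)
  (measurable_trig_pos a b al be i) (@is_derive_trig_pos R a b al be i)
  (bounded_measurable_dtrig_pos b al be a_ge0 i).
have -> : jump_term (trig_pos a b al be i) P V0 S J0 =
    al * (cos_part i * bC - sin_part i * bS)
    + be * (sin_part i * bC + cos_part i * bS)
    - (al * cos_part i + be * sin_part i).
  have b1 : bounded_measurable (fun w => C i w * pcos (S w) - D i w * psin (S w)).
    by apply: bounded_measurableB; exact: bounded_measurableM.
  have b2 : bounded_measurable (fun w => D i w * pcos (S w) + C i w * psin (S w)).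
    by apply: bounded_measurableD; exact: bounded_measurableM.
  have b3 : bounded_measurable (fun w => al * (C i w * pcos (S w) - D i w * psin (S w))
      + be * (D i w * pcos (S w) + C i w * psin (S w))).
    by apply: bounded_measurableD; exact: bounded_measurableM.
  transitivity (\int[P]_w (al * (C i w * pcos (S w) - D i w * psin (S w))
      + be * (D i w * pcos (S w) + C i w * psin (S w)) - (al * C i w + be * D i w))).
    apply: ae_eq_expect.
    - apply: measurable_funB.
        have bst := bounded_measurable_state (trig_pos_bound b al be a_ge0 i)
          (measurable_trig_pos a b al be i).
        apply: (bounded_measurable_comp bst (X := fun w => (V0 w + S w, J0 w)) _).1.
        by apply: measurable_fun_pair => //; exact: measurable_funD.
      have bst := bounded_measurable_state (trig_pos_bound b al be a_ge0 i)
          (measurable_trig_pos a b al be i).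
      exact: (bounded_measurable_comp bst mX).1.
    - by have [] := bounded_measurableB b3 (bl i).
    - apply: filterS2 V0_ge0 S_ge0 => w v0 s0.
      rewrite /C /D /pcos /psin /trig_pos /trig !max_l ?addr_ge0// dcosD dsinD.
      by ring.
  rewrite expectB// El expectD; [|exact: bounded_measurableM..].
  rewrite !expectZl// expectB; [|exact: bounded_measurableM..].
  by rewrite expectD; [|exact: bounded_measurableM..]; rewrite ECC ECS ESC ESS.
(* A switch out of [i] loses the contribution of [i]; a switch out of the other queue gains that of
   the other queue. *)
have sw j : switch_term (trig_pos a b al be i) P V0 J0 j =
    if j == i then - (al * cos_part i + be * sin_part i)
    else al * cos_part j + be * sin_part j.
  rewrite /switch_term; case: eqP => [->|/eqP ji].
    rewrite -El -expectN//; apply: eq_Rintegral => w _.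
    by rewrite /trig_pos eqxx /C /D; case: (i) => /=; rewrite /trig /pcos /psin; ring.
  rewrite -El; apply: eq_Rintegral => w _.
  by rewrite /trig_pos /C /D /pcos /psin /trig; move: ji; case: (i); case: (j) => //= _; ring.
have -> : \int[P]_w ((J0 w && (0 < V0 w))%:R * dtrig_pos a b al be i (V0 w)) =
  (true == i)%:R * ((be * b - al * a) * (cos_part i - idle_mass)
                    - (al * b + be * a) * sin_part i).
  case: i @bC @bS ECC ECS ESC ESS sw => bC bS _ _ _ _ _; last first.
    rewrite mul0r; transitivity (\int[P]_w (cst 0 w : R)); last by rewrite expect_cst.
    by apply: eq_Rintegral => w _; rewrite /dtrig_pos mul0r mulr0.
  have bz : bounded_measurable (fun w => (J0 w && ~~ (0 < V0 w))%:R : R).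
    apply: bounded_measurable_bool; apply: measurable_and => //.
    by apply: measurable_neg; exact: measurable_fun_ltr.
  (* At workload 0 the cosine part is 1 and the sine part 0, so leaving out the idle states
     subtracts exactly [Z] from the cosine part. *)
  pose Z w := (J0 w && ~~ (0 < V0 w))%:R : R.
  have bCZ : bounded_measurable (fun w => C true w - Z w) by exact: bounded_measurableB.
  have -> : cos_part true - idle_mass = \int[P]_w (C true w - Z w) by rewrite expectB.
  have -> : sin_part true = \int[P]_w D true w by [].
  rewrite mul1r -(expectZl P _ bCZ) -(expectZl P _ (bDw true)) -expectB; last 2 first.
  - exact: bounded_measurableM.
  - exact: bounded_measurableM.
  apply: eq_Rintegral => w _; rewrite /dtrig_pos /dtrig /Z /C /D /pcos /psin eqxx.
  case: (J0 w) => /=; last by rewrite !mul0r; ring.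
  case: ltP => v0 /=; first by ring.
  by rewrite dcos0 dsin0; ring.
rewrite !sw => <-; case: (i) => /=; ring.
Qed.

End balance.

(** * Expectation under a conditional law *)

Section conditional_expectation.
Context {R : realType} {d : measure_display} {T : measurableType d}.
Variable P : probability T R.

(** [P] is the sum of its restrictions to [D] and to its complement; the integrand [1_D f] agrees
    with [f] almost everywhere for the former and vanishes almost everywhere for the latter. *)
Lemma ge0_integral_mrestr (D : set T) (mD : measurable D) (f : T -> \bar R) :
  measurable_fun [set: T] f -> (forall x, 0 <= f x)%E ->
  (\int[mrestr P mD]_x f x = \int[P]_x ((\1_D x)%:E * f x))%E.
Proof.
move=> mf f0; have mDC : measurable (~` D) by exact: measurableC.
have m1f : measurable_fun [set: T] (fun x => (\1_D x)%:E * f x)%E.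
  by apply: emeasurable_funM => //; exact/measurable_EFinP/measurable_indic.
have f1 x : (0 <= (\1_D x)%:E * f x)%E by rewrite mule_ge0// lee_fin.
transitivity (\int[measure_add (mrestr P mD) (mrestr P mDC)]_x ((\1_D x)%:E * f x))%E;
  last first.
  apply: eq_measure_integral => A mA _; apply: etrans (measure_addE _ _ _) _.
  rewrite /= /mrestr.
  rewrite -measureU ?setDE -?setIUr ?setUv ?setIT//; try exact: measurableI.
  by rewrite setIACA setICr setI0.
rewrite ge0_integral_measure_add//=.
rewrite [X in (_ + X)%E](_ : _ = 0%E) ?adde0.
  apply: ge0_ae_eq_integral => //; exists (~` D); split => //.
    by rewrite /= /mrestr setICl measure0.
  by move=> x /= h Dx; apply: h => _; rewrite indicE mem_set// mul1e.
transitivity (\int[mrestr P mDC]_x (cst 0 x))%E; last by rewrite integral0.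
apply: ge0_ae_eq_integral => //; exists D; split => //.
  by rewrite /= /mrestr setICr measure0.
move=> x /= h; apply: contrapT => nDx; apply: h => _.
by rewrite indicE memNset// mul0e.
Qed.

Lemma expect_conditional (X : T -> R) (E : set T) (nu : probability R R) (g : R -> R) :
  measurable_fun [set: T] X -> measurable E -> (0 < P E)%E ->
  is_conditional_law P X E nu -> bounded_measurable g ->
  \int[nu]_y g y = (fine (P E))^-1 * \int[P]_x (\1_E x * g (X x)).
Proof.
move=> mX mE PE0 cond bg.
have PEfin : P E = (fine (P E))%:E by rewrite fineK// fin_num_measure.
have p0 : 0 < fine (P E) by rewrite -lte_fin -PEfin.
have b1 : bounded_measurable (\1_E : T -> R).
  split; first exact: measurable_indic.
  by exists 1 => x; rewrite indicE; case: (_ \in _); rewrite ?normr1 ?normr0.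
have ge0 (h : R -> R) : bounded_measurable h -> (forall x, 0 <= h x) ->
    \int[nu]_y h y = (fine (P E))^-1 * \int[P]_x (\1_E x * h (X x)).
  move=> bh h0.
  have pinv0 : 0 <= (fine (P E))^-1 by rewrite invr_ge0 ltW.
  pose r : {nonneg R} := NngNum pinv0.
  have mh : measurable_fun [set: R] (EFin \o h) by apply/measurable_EFinP; exact: bh.1.
  have mhX : measurable_fun [set: T] (EFin \o (h \o X)).
    by apply/measurable_EFinP; exact: (bounded_measurable_comp bh mX).1.
  have e : (\int[nu]_y (h y)%:E = (fine (P E))^-1%:E * \int[P]_x (\1_E x * h (X x))%:E)%E.
    transitivity (\int[pushforward (mscale r (mrestr P mE)) X]_y (h y)%:E)%E.
      apply: eq_measure_integral => A mA _; apply: etrans (cond A mA) _.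
      rewrite /pushforward /mscale/= /mrestr.
      by rewrite PEfin inver gt_eqF// muleC.
    rewrite ge0_integral_pushforward//=; last by move=> y _; rewrite lee_fin.
    rewrite preimage_setT ge0_integral_mscale//=; last by move=> x _; rewrite lee_fin.
    congr (_ * _)%E.
    by rewrite ge0_integral_mrestr//= => x; rewrite lee_fin.
  rewrite /Rintegral e fineM//; apply: integrable_fin_num => //.
  apply: bounded_measurable_integrable; apply: bounded_measurableM => //.
  exact: bounded_measurable_comp.
(* Adding its bound [K] makes [g] nonnegative; the case of the constant [K] is then subtracted. *)
have [mg [K gK]] := bg.
have bK : bounded_measurable (fun y => g y + K).
  by apply: bounded_measurableD => //; exact: bounded_measurable_cst.
have K0 : 0 <= K by apply: le_trans (gK 0).
have gK0 x : 0 <= g x + K by have := gK x; rewrite ler_norml; lra.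
have := ge0 _ bK gK0; rewrite expectD//; last exact: bounded_measurable_cst.
have := ge0 (fun=> K) (bounded_measurable_cst K) (fun=> K0) => ->.
under [in X in _ = X -> _]eq_Rintegral do rewrite mulrDr.
rewrite expectD; last 2 first.
- by apply: bounded_measurableM => //; exact: bounded_measurable_comp.
- by apply: bounded_measurableM => //; exact: bounded_measurable_cst.
by rewrite mulrDr => /addIr.
Qed.

End conditional_expectation.

(** * Uniqueness of the Laplace transform on the half-line *)

Section laplace_uniqueness.
Context {R : realType}.

(** The substitution [y = e^(-v)] maps the half-line into []0, 1]] and turns the transform at the
    integers into moments, hence into integrals of polynomials in [y]. *)
Definition pexp (v : R) := expR (- Num.max v 0).

Lemma pexp_itv v : 0 < pexp v <= 1.
Proof.
by rewrite expR_gt0 -expR0 ler_expR oppr_le0 le_max lexx orbT.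
Qed.

Lemma bounded_measurable_pexp : bounded_measurable pexp.
Proof.
split; last first.
  by exists 1 => v; have /andP[v0 v1] := pexp_itv v; rewrite ger0_norm// ltW.
apply: (measurableT_comp (@measurable_expR R)); apply: measurable_funN.
exact: measurable_maxr.
Qed.

Lemma bounded_measurable_pexpX k : bounded_measurable (fun v => pexp v ^+ k).
Proof.
elim: k => [|k IH]; first exact: bounded_measurable_cst.
by under eq_fun do rewrite exprS; apply: bounded_measurableM => //; exact: bounded_measurable_pexp.
Qed.

Lemma bounded_measurable_horner_pexp (p : {poly R}) :
  bounded_measurable (fun v => p.[pexp v]).
Proof.
elim/poly_ind: p => [|p c IH].
  by under eq_fun do rewrite horner0; exact: bounded_measurable_cst.
under eq_fun do rewrite hornerMXaddC.
apply: bounded_measurableD; last exact: bounded_measurable_cst.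
by apply: bounded_measurableM => //; exact: bounded_measurable_pexp.
Qed.

Lemma bernoulli_lower (t : R) N : 0 <= t <= 1 -> 1 - N%:R * t <= (1 - t) ^+ N.
Proof.
move=> /andP[t0 t1]; elim: N => [|N IH]; first by rewrite expr0 mul0r subr0.
rewrite exprS; apply: (@le_trans _ _ ((1 - t) * (1 - N%:R * t))).
  have h : 0 <= N%:R * (t * t) by rewrite !mulr_ge0.
  by rewrite -natr1; nra.
by rewrite ler_wpM2l// subr_ge0.
Qed.

(** The induction step is [(1 - t) * (1 + N.+1%:R * t) <= 1 + N%:R * t]. This bound makes the power
    small when [N%:R * t] is large, while [bernoulli_lower] keeps it near 1 when [N%:R * t] is
    small. *)
Lemma bernoulli_upper (t : R) N : 0 <= t <= 1 -> (1 - t) ^+ N * (1 + N%:R * t) <= 1.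
Proof.
move=> /andP[t0 t1]; elim: N => [|N IH]; first by rewrite expr0 mul0r addr0 mulr1.
apply: le_trans IH; rewrite exprSr -mulrA ler_wpM2l ?exprn_ge0 ?subr_ge0//.
have h : 0 <= N%:R * (t * t) by rewrite !mulr_ge0.
by have := mulr_ge0 t0 t0; rewrite -natr1; nra.
Qed.

(* With [N = n (floor (e^(n x)) + 1)], the polynomial [(1 - y^n)^N] at [y = e^-v]
   tends to the indicator of [v > x]: [N y^n] is at least [n] when [v <= x]
   and tends to 0 when [v > x]. *)
Definition tail_exponent (x : R) n := (n * (Num.truncn (expR (n%:R * x))).+1)%N.
Definition tail_poly (x : R) n : {poly R} := (1 - 'X^n) ^+ tail_exponent x n.

Lemma tail_polyE x n v : 0 <= v ->
  (tail_poly x n).[pexp v] = (1 - expR (- (n%:R * v))) ^+ tail_exponent x n.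
Proof.
move=> v0; rewrite /tail_poly horner_exp hornerD hornerN hornerXn hornerE.
by rewrite /pexp max_l// -expRM_natl mulrN.
Qed.

Lemma tail_poly_bound x n v : `|(tail_poly x n).[pexp v]| <= 1.
Proof.
rewrite /tail_poly horner_exp hornerD hornerN hornerXn hornerE.
have /andP[p0 p1] := pexp_itv v.
have pn0 : 0 <= pexp v ^+ n by rewrite exprn_ge0// ltW.
have pn1 : pexp v ^+ n <= 1 by rewrite exprn_ile1// ltW.
rewrite ger0_norm ?exprn_ge0 ?subr_ge0// exprn_ile1 ?subr_ge0//.
by rewrite lerBlDr lerDl.
Qed.

Lemma tail_exponent_ge x n : n%:R * expR (n%:R * x) <= (tail_exponent x n)%:R.
Proof. by rewrite /tail_exponent natrM ler_wpM2l// ltW// truncnS_gt. Qed.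

Lemma tail_exponent_le x n : 0 <= x ->
  (tail_exponent x n)%:R <= 2 * n%:R * expR (n%:R * x).
Proof.
move=> x0; rewrite /tail_exponent natrM [2 * _]mulrC -mulrA ler_wpM2l// -natr1 mulr2n mulrDl mul1r.
apply: lerD; first by rewrite truncn_le ?expR_ge0.
by rewrite -expR0 ler_expR mulr_ge0.
Qed.

(** This is the square of [y / 2 <= expR (y / 2)]; quadratic growth is enough to beat the factor [n]
    in [n e^(-n (v - x))]. *)
Lemma expR_ge_sqr (y : R) : 0 <= y -> y ^+ 2 / 4 <= expR y.
Proof.
move=> y0; have h : y / 2 <= expR (y / 2) by have := expR_ge1Dx (y / 2); lra.
have -> : expR y = expR (y / 2) ^+ 2 by rewrite expr2 -expRD -splitr.
have -> : y ^+ 2 / 4 = (y / 2) ^+ 2 by field.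
by rewrite ler_pXn2r// nnegrE ?expR_ge0// divr_ge0.
Qed.

Lemma tail_poly_cvg (x v : R) : 0 <= x -> 0 <= v ->
  (tail_poly x n).[pexp v] @[n --> \oo] --> ((x < v)%R%:R : R).
Proof.
move=> x0 v0; have t01 n : 0 <= expR (- (n%:R * v)) <= 1.
  by rewrite expR_ge0/= -expR0 ler_expR oppr_le0 mulr_ge0.
have [xv|vx] := ltP x v; rewrite /= ?mulr1n ?mulr0n;
  apply/cvgrPdist_le => e e0; near=> n; rewrite tail_polyE//.
(* Case [x < v]. With [N] the exponent and [t = e^(-n v)], one has [N t <= 2 n e^(-n (v - x)) <= 8 /
   ((v - x)^2 n)], and the lower Bernoulli bound applies. *)
- have n0 : (0 < n)%N by near: n; exact: nbhs_infty_gt.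
  have nR0 : 0 < n%:R :> R by rewrite ltr0n.
  have d0 : 0 < v - x by rewrite subr_gt0.
  have ub : (1 - expR (- (n%:R * v))) ^+ tail_exponent x n <= 1.
    by have /andP[? ?] := t01 n; rewrite exprn_ile1; lra.
  rewrite ger0_norm ?subr_ge0//.
  have := bernoulli_lower (tail_exponent x n) (t01 n).
  suff : (tail_exponent x n)%:R * expR (- (n%:R * v)) <= e by lra.
  apply: (@le_trans _ _ (2 * n%:R * expR (n%:R * x) * expR (- (n%:R * v)))).
    by rewrite ler_wpM2r ?expR_ge0// tail_exponent_le.
  rewrite -mulrA -expRD (_ : n%:R * x + - (n%:R * v) = - (n%:R * (v - x))); last by ring.
  have /(expR_ge_sqr) : 0 <= n%:R * (v - x) by rewrite mulr_ge0// ltW.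
  rewrite expRN => sq.
  have y0 : 0 < (n%:R * (v - x)) ^+ 2 / 4 by rewrite divr_gt0// exprn_gt0// mulr_gt0.
  apply: (@le_trans _ _ (2 * n%:R * ((n%:R * (v - x)) ^+ 2 / 4)^-1)).
    by rewrite ler_wpM2l ?mulr_ge0// lef_pV2 ?posrE ?expR_gt0.
  have -> : 2 * n%:R * ((n%:R * (v - x)) ^+ 2 / 4)^-1 = 8 / (v - x) ^+ 2 / n%:R.
    by field; rewrite !gt_eqF// lt0r_neq0.
  rewrite ler_pdivrMr// [e * _]mulrC -ler_pdivrMr//.
  near: n; exact: nbhs_infty_ger.
(* Case [v <= x], equality included: [N t >= n], so the upper Bernoulli bound gives at most
   [1 / n]. *)
- have n0 : (0 < n)%N by near: n; exact: nbhs_infty_gt.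
  have nR0 : 0 < n%:R :> R by rewrite ltr0n.
  have /andP[u0 u1] := t01 n.
  have ge0 : 0 <= (1 - expR (- (n%:R * v))) ^+ tail_exponent x n.
    by rewrite exprn_ge0// subr_ge0.
  rewrite sub0r normrN ger0_norm//.
  have := bernoulli_upper (tail_exponent x n) (t01 n).
  have : n%:R <= (tail_exponent x n)%:R * expR (- (n%:R * v)).
    apply: (@le_trans _ _ (n%:R * expR (n%:R * x) * expR (- (n%:R * v)))); last first.
      by rewrite ler_wpM2r// tail_exponent_ge.
    rewrite -mulrA -expRD ler_peMr// -expR0 ler_expR -mulrN -mulrDr mulr_ge0// subr_ge0//.
  set q := (1 - _) ^+ _ in ge0 *; set t := _ * expR _ => nt qt.
  have : q * n%:R <= 1.
    by apply: le_trans qt; rewrite ler_wpM2l//; lra.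
  rewrite -ler_pdivlMr// => /le_trans; apply.
  rewrite ler_pdivrMr// [e * _]mulrC -ler_pdivrMr//.
  near: n; exact: nbhs_infty_ger.
Unshelve. all: by end_near. Qed.

Variables m1 m2 : probability R R.
Hypothesis m1_ge0 : {ae m1, forall x, 0 <= x}.
Hypothesis m2_ge0 : {ae m2, forall x, 0 <= x}.
Hypothesis m12 : forall n, \int[m1]_v (pexp v ^+ n) = \int[m2]_v (pexp v ^+ n).

Lemma laplace_horner (p : {poly R}) : \int[m1]_v p.[pexp v] = \int[m2]_v p.[pexp v].
Proof.
(* The extra power absorbs the factor ['X] of the induction step on polynomials. *)
suff H k : \int[m1]_v (p.[pexp v] * pexp v ^+ k) = \int[m2]_v (p.[pexp v] * pexp v ^+ k).
  by have := H 0%N; under eq_Rintegral do rewrite expr0 mulr1;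
    under [in X in _ = X -> _]eq_Rintegral do rewrite expr0 mulr1.
elim/poly_ind: p k => [|p c IH] k.
  by under eq_Rintegral do rewrite horner0 mul0r;
     under [in RHS]eq_Rintegral do rewrite horner0 mul0r; rewrite !Rintegral_cst// !mul0r.
have e v : (p * 'X + c%:P).[pexp v] * pexp v ^+ k = p.[pexp v] * pexp v ^+ k.+1 + c * pexp v ^+ k.
  by rewrite hornerMXaddC exprS; ring.
under eq_Rintegral do rewrite e; under [in RHS]eq_Rintegral do rewrite e.
have b1 : bounded_measurable (fun v => p.[pexp v] * pexp v ^+ k.+1).
  apply: bounded_measurableM; first exact: bounded_measurable_horner_pexp.
  exact: bounded_measurable_pexpX.
have bk := bounded_measurable_pexpX k.
have b2 : bounded_measurable (fun v => c * pexp v ^+ k).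
  by apply: bounded_measurableM => //; exact: bounded_measurable_cst.
by rewrite !expectD// !expectZl// IH m12.
Qed.

(** The integrals of the tail polynomials converge to the mass of []x, +oo[] for [x >= 0], and for
    [x < 0] that mass is 1 under both laws. These rays generate the Borel sets and are closed under
    intersection. *)
Lemma laplace_unique (A : set R) : measurable A -> m1 A = m2 A.
Proof.
have mitv (x : R) : measurable (`]x, +oo[%classic : set R) by exact: measurable_itv.
have lim (m : probability R R) (m_ge0 : {ae m, forall x, 0 <= x}) x : 0 <= x ->
    \int[m]_v (tail_poly x n).[pexp v] @[n --> \oo] --> fine (m `]x, +oo[%classic).
  move=> x0; rewrite -(@expect_bool _ _ _ m (fun v => x < v)); last 2 first.
  - exact: mitv.
  - by move=> v; rewrite /= in_itv/= andbT.
  apply: (@dominated_expect _ _ _ _ _ _ 1).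
  - by move=> n; have [] := bounded_measurable_horner_pexp (tail_poly x n).
  - by apply: nearW => v n; exact: tail_poly_bound.
  - by apply: filterS m_ge0 => v v0; exact: tail_poly_cvg.
  - have [] // := @bounded_measurable_bool R _ _ (fun v : R => x < v).
    exact: measurable_fun_ltr.
have tail x : m1 `]x, +oo[%classic = m2 `]x, +oo[%classic.
  have [x0|x0] := leP 0 x.
    have := lim _ m2_ge0 _ x0; under eq_cvg do rewrite -laplace_horner.
    move=> /(cvg_unique _ (lim _ m1_ge0 _ x0)) => e.
    by rewrite -(fineK (fin_num_measure m1 _ (mitv x))) e// fineK// fin_num_measure.
  have full (m : probability R R) : {ae m, forall x, 0 <= x} -> m `]x, +oo[%classic = 1%E.
    move=> m_ge0; rewrite -[LHS]fineK ?fin_num_measure//; congr EFin.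
    rewrite -(@expect_bool _ _ _ m (fun v => x < v)); last 2 first.
    - exact: mitv.
    - by move=> v; rewrite /= in_itv/= andbT.
    rewrite -[RHS](expect_cst m 1); apply: ae_eq_expect => //.
      have [] // := @bounded_measurable_bool R _ _ (fun v : R => x < v).
      exact: measurable_fun_ltr.
    by apply: filterS m_ge0 => y y0; rewrite (lt_le_trans x0).
  by rewrite !full.
move=> mA; apply: (@measure_unique _ R _
  [set B : set R | exists x : R, B = `]x, +oo[%classic]
  (fun n => `](- n%:R : R), +oo[%classic) _ _ _ _ m1 m2 _ _ A mA).
- exact: RGenOInfty.measurableE.
- move=> _ _ [x ->] [y ->]; exists (Num.max x y); apply/seteqP; split => z /=;
    rewrite !in_itv/= !andbT gt_max.
    by move=> [-> ->].
  by move=> /andP[-> ->].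
- by move=> i; eexists.
- apply/seteqP; split => // z _; exists (Num.truncn `|z|).+1 => //=.
  rewrite in_itv/= andbT ltrNl (le_lt_trans (ler_norm _))// normrN.
  exact: truncnS_gt.
- by move=> _ [x ->]; exact: tail.
- by move=> k; rewrite (le_lt_trans (probability_le1 _ _))// ltry.
Qed.

End laplace_uniqueness.

(** * Transforms and their behaviour at 0 *)

Section transform_equations.
Context {R : realType} {d : measure_display} {T : measurableType d}.
Variables (P : probability T R) (lambda : R) (c : bool -> R).
Variables (V0 S : T -> R) (J0 : T -> bool).
Hypothesis gen : generator_identity P lambda c V0 S J0.
Hypothesis mV0 : measurable_fun [set: T] V0.
Hypothesis mS : measurable_fun [set: T] S.
Hypothesis mJ0 : measurable_fun [set: T] J0.
Hypothesis V0_ge0 : {ae P, forall w, 0 <= V0 w}.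
Hypothesis S_ge0 : {ae P, forall w, 0 <= S w}.
Hypothesis indep : independent_pair P (fun w => (V0 w, J0 w)) S.

Definition transform (X : T -> R) (s : R[i]) : R[i] :=
  Complex (\int[P]_w pcos (complex.Re s) (complex.Im s) (X w))
          (- \int[P]_w psin (complex.Re s) (complex.Im s) (X w)).

Definition state_transform (j : bool) (s : R[i]) : R[i] :=
  Complex (cos_part P V0 J0 (complex.Re s) (complex.Im s) j)
          (- sin_part P V0 J0 (complex.Re s) (complex.Im s) j).

Let p0 := idle_mass P V0 J0.
Local Open Scope complex_scope.

(** The real and imaginary parts are [trig_balance] with coefficients [(1, 0)] and [(0, 1)]. *)
Lemma complex_balance (s : R[i]) (i : bool) : 0 <= complex.Re s ->
  lambda%:C * (1 - transform S s) * state_transform i s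
  + (c i)%:C * state_transform i s =
  (c (~~ i))%:C * state_transform (~~ i) s
  + (true == i)%:R * s * (state_transform i s - p0%:C).
Proof.
case: s => a b /= a0.
have re := trig_balance gen mV0 mS mJ0 V0_ge0 S_ge0 indep b a0 i 1 0.
have im := trig_balance gen mV0 mS mJ0 V0_ge0 S_ge0 indep b a0 i 0 1.
rewrite /transform /state_transform /=.
cbv zeta in re, im; rewrite -/p0 in re im.
set C1 := cos_part P V0 J0 a b i in re im *.
set S1 := sin_part P V0 J0 a b i in re im *.
set C2 := cos_part P V0 J0 a b (~~ i) in re im *.
set S2 := sin_part P V0 J0 a b (~~ i) in re im *.
set bC := \int[P]_w pcos a b (S w) in re im *.
set bS := \int[P]_w psin a b (S w) in re im *.
apply/eqP; rewrite eq_complex; apply/andP; split; apply/eqP.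
  by case: (true == i) re im; simpc => /=; lra.
by case: (true == i) re im; simpc => /=; lra.
Qed.

End transform_equations.

Section LST_facts.
Context {R : realType}.
Variable m : probability R R.
Hypothesis m_ge0 : {ae m, forall x, 0 <= x}.

Lemma LST_transform (s : R[i]) : LST m s = transform m id s.
Proof.
rewrite /LST /transform; congr (Complex _ (- _)); apply: ae_eq_expect.
- exact: measurable_dcos.
- apply: (measurableT_comp (measurable_dcos _ _)); exact: measurable_maxr.
- by apply: filterS m_ge0 => x x0; rewrite /pcos /dcos max_l.
- exact: measurable_dsin.
- apply: (measurableT_comp (measurable_dsin _ _)); exact: measurable_maxr.
- by apply: filterS m_ge0 => x x0; rewrite /psin /dsin max_l.
Qed.

Lemma transform_has_law {d : measure_display} {T : measurableType d}
    (P : probability T R) (X : T -> R) (s : R[i]) : 0 <= complex.Re s ->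
  has_law P X m -> transform P X s = transform m id s.
Proof.
move=> s0 Xm; rewrite /transform.
by rewrite !(expect_has_law Xm)//; [exact: bounded_measurable_psin|exact: bounded_measurable_pcos].
Qed.

End LST_facts.

(** * The derivative of the service transform at 0 *)

Section mean_limit.
Context {R : realType}.
Variable B : probability R R.
Hypothesis B_ge0 : {ae B, forall x, 0 <= x}.
Hypothesis B_mean : (mean B < +oo)%E.

Lemma pcos_real (a v : R) : pcos a 0 v = expR (- (a * Num.max v 0)).
Proof. by rewrite /pcos /dcos mul0r cos0 mulr1. Qed.

Lemma mean_max : mean B = (\int[B]_x (Num.max x 0)%:E)%E.
Proof.
apply: ae_eq_integral => //.
  by apply/measurable_EFinP; exact: measurable_maxr.
by apply: filterS B_ge0 => x x0 _; rewrite max_l.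
Qed.

(** The quotient [(1 - e^(-h x)) / h] lies between [x - h x^2] and [x]. The lower bound serves for
    the pointwise limit only, so domination by [x], that is a finite mean, suffices. *)
Lemma mean_limit :
  (harmonic n)^-1 * (1 - \int[B]_x pcos (harmonic n) 0 x) @[n --> \oo] --> fine (mean B).
Proof.
have bq a : 0 <= a -> bounded_measurable (fun x : R => a^-1 * (1 - pcos a 0 x)).
  move=> a0; apply: bounded_measurableM; first exact: bounded_measurable_cst.
  by apply: bounded_measurableB; [exact: bounded_measurable_cst|exact: bounded_measurable_pcos].
have E n : (harmonic n)^-1 * (1 - \int[B]_x pcos (harmonic n) 0 x) =
    \int[B]_x ((harmonic n)^-1 * (1 - pcos (harmonic n) 0 x)).
  have bp : bounded_measurable (pcos (harmonic n) 0 : R -> R).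
    by apply: bounded_measurable_pcos; exact: harmonic_ge0.
  have b1 : bounded_measurable (fun _ : R => 1 : R) by exact: bounded_measurable_cst.
  by rewrite (expectZl _ _ (bounded_measurableB b1 bp)) (expectB _ b1 bp) (expect_cst B 1).
under eq_cvg do rewrite E.
rewrite mean_max.
have mmax : measurable_fun [set: R] (fun x : R => Num.max x 0) by exact: measurable_maxr.
have max0 (x : R) : 0 <= Num.max x 0 by exact: max0_ge0.
have imax : B.-integrable [set: R] (fun x => (Num.max x 0)%:E).
  apply/integrableP; split; first exact/measurable_EFinP.
  by under eq_integral do rewrite gee0_abs ?lee_fin//; rewrite -mean_max.
have q_itv n (x : R) : 0 <= (harmonic n)^-1 * (1 - pcos (harmonic n) 0 x) <= Num.max x 0.
  have h0 := @harmonic_gt0 R n; rewrite pcos_real.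
  have /(one_sub_expRN) /andP[_ u] : 0 <= harmonic n * Num.max x 0 by rewrite mulr_ge0// ltW.
  apply/andP; split.
    apply: mulr_ge0; first by rewrite invr_ge0 ltW.
    by rewrite subr_ge0 -expR0 ler_expR oppr_le0 mulr_ge0// ltW.
  by rewrite ler_pdivrMl.
have := @dominated_convergence _ R R B setT measurableT
  (fun n x => ((harmonic n)^-1 * (1 - pcos (harmonic n) 0 x))%:E)
  (fun x => (Num.max x 0)%:E) (fun x => (Num.max x 0)%:E).
case=> //.
- by move=> n; apply/measurable_EFinP; case: (bq (harmonic n) (harmonic_ge0 n)).
- exact/measurable_EFinP.
- apply: nearW => x _; apply: cvg_EFin; first exact: nearW.
  have lim0 : Num.max x 0 - harmonic n * Num.max x 0 ^+ 2 @[n --> \oo] --> Num.max x 0.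
    rewrite -[X in _ --> X]subr0 -[X in _ - X](mul0r (Num.max x 0 ^+ 2)).
    by apply: cvgB; [exact: cvg_cst|apply: cvgMl; exact: cvg_harmonic].
  apply: (squeeze_cvgr _ lim0 (cvg_cst _)); apply: nearW => n.
  have h0 := @harmonic_gt0 R n; have /andP[_ ub] := q_itv n x.
  apply/andP; split; last exact: ub.
  suff : Num.max x 0 - harmonic n * Num.max x 0 ^+ 2 <=
    (harmonic n)^-1 * (1 - pcos (harmonic n) 0 x) by [].
  rewrite pcos_real ler_pdivlMl//.
  have /(one_sub_expRN) /andP[u _] : 0 <= harmonic n * Num.max x 0 by rewrite mulr_ge0// ltW.
  by apply: le_trans u; rewrite le_eqVlt; apply/orP; left; apply/eqP; ring.
- by apply: nearW => x n _ /=; rewrite lee_fin; have /andP[u v] := q_itv n x; rewrite ger0_norm.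
- move=> _ _ h; apply: fine_cvg => /=; rewrite fineK//.
  exact: integrable_fin_num.
Qed.

End mean_limit.

(** * Balance at real arguments and the stationary probabilities *)

Section real_balance.
Context {R : realType} {d : measure_display} {T : measurableType d}.
Variables (P : probability T R) (lambda : R) (c : bool -> R) (B : probability R R).
Variables (V0 S : T -> R) (J0 : T -> bool).
Hypothesis gen : generator_identity P lambda c V0 S J0.
Hypothesis mV0 : measurable_fun [set: T] V0.
Hypothesis mJ0 : measurable_fun [set: T] J0.
Hypothesis V0_ge0 : {ae P, forall w, 0 <= V0 w}.
Hypothesis SB : has_law P S B.
Hypothesis B_ge0 : {ae B, forall x, 0 <= x}.
Hypothesis B_mean : (mean B < +oo)%E.
Hypothesis S_ge0 : {ae P, forall w, 0 <= S w}.
Hypothesis indep : independent_pair P (fun w => (V0 w, J0 w)) S.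

Let mS : measurable_fun [set: T] S. Proof. by case: SB. Qed.

Let L (a : R) j := cos_part P V0 J0 a 0 j.
Let b (a : R) := \int[B]_x pcos a 0 x.
Let p0 := idle_mass P V0 J0.
Let pj j := \int[P]_w ((J0 w == j)%:R : R).

Lemma sin_part_real a j : sin_part P V0 J0 a 0 j = 0.
Proof.
rewrite /sin_part -[RHS](expect_cst P 0); apply: eq_Rintegral => w _.
by rewrite /psin /dsin mul0r sin0 !mulr0.
Qed.

Lemma real_balance a j : 0 <= a ->
  lambda * (1 - b a) * L a j + c j * L a j =
  c (~~ j) * L a (~~ j) + (true == j)%:R * a * (L a j - p0).
Proof.
move=> a0; have := trig_balance gen mV0 mS mJ0 V0_ge0 S_ge0 indep 0 a0 j 1 0.
rewrite /= !sin_part_real (expect_has_law SB) -/(b a); last exact: bounded_measurable_pcos.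
rewrite -/(L a j) -/(L a (~~ j)) -/p0; lra.
Qed.

Lemma cos_part_limit j : L (harmonic n) j @[n --> \oo] --> pj j.
Proof.
have bj : bounded_measurable (fun w => (J0 w == j)%:R : R) := bounded_measurable_eqb j mJ0.
apply: (@dominated_expect _ _ _ _ _ _ 1).
- move=> n; apply: (bounded_measurableM bj _).1.
  by apply: (bounded_measurable_comp _ mV0); apply: bounded_measurable_pcos; exact: harmonic_ge0.
- apply: nearW => w n; rewrite normrM mulr_ile1//; first by case: eqP; rewrite ?normr1 ?normr0.
  by rewrite dcos_le1 ?harmonic_ge0// le_max lexx orbT.
- apply: nearW => w.
  have lim : expR (- (harmonic n * Num.max (V0 w) 0)) @[n --> \oo] -->
      expR (- (0 * Num.max (V0 w) 0)).
    apply: continuous_cvg; first exact: continuous_expR.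
    by apply: cvgN; apply: cvgMl; exact: cvg_harmonic.
  rewrite mul0r oppr0 expR0 in lim.
  have {}lim : (J0 w == j)%:R * expR (- (harmonic n * Num.max (V0 w) 0)) @[n --> \oo] -->
      ((J0 w == j)%:R * 1 : R) by apply: cvgMr.
  rewrite mulr1 in lim; apply: cvg_trans lim; apply: near_eq_cvg; apply: nearW => n.
  by rewrite pcos_real.
- exact: bj.1.
Qed.

(** Adding the two balance equations cancels the switching terms and leaves a factor [a] on the
    right; after division by [a], the limit at 0 brings in the mean service time. *)
Lemma idle_mass_eq : p0 = pj true - lambda * fine (mean B) * (pj true + pj false).
Proof.
have sum a : 0 < a -> lambda * (a^-1 * (1 - b a)) * (L a true + L a false) = L a true - p0.
  move=> a0; have := real_balance true (ltW a0); have := real_balance false (ltW a0) => /=.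
  rewrite mul1r !mul0r => e1 e2.
  have {}e : lambda * (1 - b a) * (L a true + L a false) = a * (L a true - p0) by lra.
  apply: (mulfI (lt0r_neq0 a0)); rewrite -e; field.
  by rewrite gt_eqF.
have lim1 : L (harmonic n) true - p0 @[n --> \oo] --> pj true - p0.
  by apply: cvgB; [exact: cos_part_limit|exact: cvg_cst].
have lim2 : lambda * ((harmonic n)^-1 * (1 - b (harmonic n)))
    * (L (harmonic n) true + L (harmonic n) false) @[n --> \oo] -->
    lambda * fine (mean B) * (pj true + pj false).
  apply: cvgM; first by apply: cvgMr; exact: mean_limit.
  by apply: cvgD; exact: cos_part_limit.
suff : pj true - p0 = lambda * fine (mean B) * (pj true + pj false) by lra.
have lim3 : L (harmonic n) true - p0 @[n --> \oo] -->
    lambda * fine (mean B) * (pj true + pj false).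
  apply: cvg_trans lim2; apply: near_eq_cvg; apply: nearW => n.
  by rewrite sum// harmonic_gt0.
exact: (cvg_unique _ lim1 lim3).
Qed.

(** At [a = 0] the arrival term vanishes, and the equation for [false] only equates the two
    switching rates. *)
Lemma switch_balance : c true * pj true = c false * pj false.
Proof.
have e : lambda * (1 - b 0) * L 0 false + c false * L 0 false = c true * L 0 true.
  by have := real_balance false (lexx 0) => /=; rewrite !mul0r addr0.
have L0 j : L 0 j = pj j.
  by apply: eq_Rintegral => w _; rewrite pcos_real mul0r oppr0 expR0 mulr1.
have b0 : b 0 = 1.
  by rewrite -[RHS](expect_cst B 1); apply: eq_Rintegral => x _;
    rewrite pcos_real mul0r oppr0 expR0.
by move: e; rewrite b0 subrr mulr0 mul0r add0r !L0.
Qed.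

Lemma state_mass : pj true + pj false = 1.
Proof.
have bj j : bounded_measurable (fun w => (J0 w == j)%:R : R).
  exact: bounded_measurable_eqb.
rewrite -expectD// -[RHS](expect_cst P 1); apply: eq_Rintegral => w _.
by case: (J0 w); rewrite /= ?addr0 ?add0r.
Qed.

End real_balance.

Section nonnegative_laws.
Context {R : realType}.

Let mneg : measurable (`]-oo, 0[%classic : set R).
Proof. exact: measurable_itv. Qed.

Lemma ae_ge0P (m : probability R R) :
  {ae m, forall x, 0 <= x} <-> m `]-oo, 0[%classic = 0%E.
Proof.
split=> [[N [mN N0 subN]]|m0].
  apply/eqP; rewrite eq_le measure_ge0 andbT -N0 le_measure ?inE// => x /=.
  by rewrite in_itv/= => x0; apply: subN => /=; apply/negP; rewrite -ltNge.
exists `]-oo, 0[%classic; split => // x /= /negP; rewrite -ltNge.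
by rewrite in_itv.
Qed.

Context {d : measure_display} {T : measurableType d} (P : probability T R).

Lemma has_law_ae_ge0 (X : T -> R) (m : probability R R) : has_law P X m ->
  {ae P, forall w, 0 <= X w} <-> {ae m, forall x, 0 <= x}.
Proof.
move=> [mX Xm]; have mN : measurable (X @^-1` `]-oo, 0[%classic).
  by rewrite -[_ @^-1` _]setTI; exact: mX.
rewrite ae_ge0P -Xm//; split=> [[N [mN' N0 subN]]|P0].
  apply/eqP; rewrite eq_le measure_ge0 andbT -N0 le_measure ?inE// => w /=.
  by rewrite in_itv/= => x0; apply: subN => /=; apply/negP; rewrite -ltNge.
exists (X @^-1` `]-oo, 0[%classic); split => // w /= /negP; rewrite -ltNge.
by rewrite in_itv.
Qed.

End nonnegative_laws.

(** * Continuity of a transform at 0 *)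

Section LST_continuity.
Context {R : realType}.
Local Open Scope complex_scope.

Lemma normc_le (z : R[i]) : `|z| <= (`|complex.Re z| + `|complex.Im z|)%:C.
Proof.
rewrite normc_def lecR -[leRHS]ger0_norm ?addr_ge0// -sqrtr_sqr ler_sqrt ?sqr_ge0//.
rewrite sqrrD !real_normK ?num_real// lerD2r lerDl.
by rewrite mulrn_wge0// mulr_ge0.
Qed.

Lemma normc_Re_le (z : R[i]) (r : R) : `|z| <= r%:C -> `|complex.Re z| <= r.
Proof. by move=> /(le_trans (normc_ge_Re z)); rewrite lecR. Qed.

Lemma normc_Im_le (z : R[i]) (r : R) : `|z| <= r%:C -> `|complex.Im z| <= r.
Proof.
rewrite normc_def lecR; apply: le_trans; rewrite -sqrtr_sqr ler_sqrt ?addr_ge0 ?sqr_ge0//.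
by rewrite lerDr sqr_ge0.
Qed.

Variable m : probability R R.
Hypothesis m_ge0 : {ae m, forall x, 0 <= x}.

(** It controls how far each component of [e^(-s v)] is from its value at [v = 0] when [Re s] and
    [|Im s|] are at most [t]: the Lipschitz constant is then at most [2 * t]. The cap 2 makes it
    integrable without any moment of [m]. *)
Let bound (t v : R) := Num.min 2 (2 * (t * Num.max v 0)).

Let bound_itv t v : 0 <= t -> 0 <= bound t v <= 2.
Proof.
by move=> t0; rewrite ge_min lexx/= andbT le_min ler0n/= mulr_ge0// mulr_ge0// max0_ge0.
Qed.

Let bounded_measurable_bound t : 0 <= t -> bounded_measurable (bound t).
Proof.
move=> t0; split; last first.
  by exists 2 => v; have /andP[b0 b2] := bound_itv v t0; rewrite ger0_norm.
apply: measurable_minr => //; apply: measurable_funM => //; apply: measurable_funM => //.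
exact: measurable_maxr.
Qed.

Let bound_cvg : \int[m]_v bound (harmonic n) v @[n --> \oo] --> (0 : R).
Proof.
rewrite -[X in _ --> X](expect_cst m 0).
apply: (@dominated_expect _ _ _ _ _ _ 2).
- by move=> n; case: (bounded_measurable_bound (@harmonic_ge0 R n)).
- apply: nearW => v n; have /andP[b0 b2] := bound_itv v (@harmonic_ge0 R n).
  by rewrite ger0_norm.
- apply: nearW => v.
  have lim : 2 * (harmonic n * Num.max v 0) @[n --> \oo] --> 2 * (0 * Num.max v 0).
    by apply: cvgMr; apply: cvgMl; exact: cvg_harmonic.
  rewrite mul0r mulr0 in lim.
  apply: (squeeze_cvgr _ (cvg_cst _) lim); apply: nearW => n.
  by have /andP[b0 _] := bound_itv v (@harmonic_ge0 R n); rewrite b0 ge_min lexx orbT.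
- exact: measurable_cst.
Qed.

Let trig_dist al be a b t v : 0 <= a <= t -> `|b| <= t ->
  (al == 1) && (be == 0) || (al == 0) && (be == 1) ->
  `|trig a b al be (Num.max v 0) - trig a b al be 0| <= bound t v.
Proof.
move=> /andP[a0 at_] bt albe; rewrite le_min; apply/andP; split.
  rewrite (le_trans (ler_normB _ _))//.
  have := trig_bound b al be a0 (max0_ge0 v); have := trig_bound b al be a0 (lexx 0).
  by case/orP: albe => /andP[/eqP -> /eqP ->]; rewrite normr0 normr1; lra.
rewrite (le_trans (trig_lipschitz b al be a0 (max0_ge0 v) (lexx 0)))// subr0.
rewrite (ger0_norm (max0_ge0 v)) mulrA ler_wpM2r ?max0_ge0//.
by case/orP: albe => /andP[/eqP -> /eqP ->]; rewrite normr0 normr1; lra.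
Qed.

Lemma LST_cvg0 : (LST m : R[i]^o -> R[i]^o) s
  @[s --> within [set s : R[i]^o | 0 <= complex.Re s] (0 : R[i]^o)^']
  --> (LST m 0 : R[i]^o).
Proof.
apply/cvgrPdist_le => /= e e0.
have [er e_real] : 0 < complex.Re e /\ e = (complex.Re e)%:C.
  move: e0; rewrite ltcE/= => /andP[/eqP e1 e2]; split=> //.
  by case: e e1 e2 => x y /= -> _.
(* The factor 2 accounts for the real and the imaginary part. *)
have [n hn] : exists n, 2 * \int[m]_v bound (harmonic n) v <= complex.Re e.
  have e2 : 0 < complex.Re e / 2 by rewrite divr_gt0.
  have /cvgrPdist_le /(_ _ e2) [n _ hn] := bound_cvg.
  exists n; have := hn n (leqnn n); rewrite sub0r normrN.
  by move=> /(le_trans (ler_norm _)); lra.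
have t0 := @harmonic_gt0 R n; set t := harmonic n in hn t0.
suff : \forall s \near nbhs (0 : R[i]^o), 0 <= complex.Re s -> `|LST m 0 - LST m s| <= e.
  by apply: filterS => s hs _ /= s0; exact: hs.
apply/nbhs_ballP; exists (t%:C : R[i]); first by rewrite /= ltcR.
move=> s; rewrite /ball/= sub0r normrN => st s0.
have re_t : 0 <= complex.Re s <= t.
  by rewrite s0 (le_trans (ler_norm _))// normc_Re_le// ltW.
have im_t : `|complex.Im s| <= t by rewrite normc_Im_le// ltW.
rewrite !LST_transform// e_real (le_trans (normc_le _))// lecR.
apply: le_trans hn; rewrite mulr_natl mulr2n.
have bp := bounded_measurable_pcos (complex.Im s) s0.
have bs := bounded_measurable_psin (complex.Im s) s0.
have bb := bounded_measurable_bound (ltW t0).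
have c0 : \int[m]_v pcos 0 0 (id v) = 1.
  rewrite -[RHS](expect_cst m 1); apply: eq_Rintegral => v _.
  by rewrite pcos_real mul0r oppr0 expR0.
have z0 : \int[m]_v psin 0 0 (id v) = 0.
  rewrite -[RHS](expect_cst m 0); apply: eq_Rintegral => v _.
  by rewrite /psin /dsin mul0r sin0 mulr0.
apply: lerD.
  rewrite /transform /= c0 -opprB normrN -[X in _ - X](expect_cst m 1).
  rewrite -expectB//; last exact: bounded_measurable_cst.
  have b1 : bounded_measurable (fun v => pcos (complex.Re s) (complex.Im s) v - cst 1 v).
    by apply: bounded_measurableB => //; exact: bounded_measurable_cst.
  apply: le_trans (expect_norm_le m b1) _.
  apply: ae_le_expect => //; first exact: bounded_measurable_norm.
  apply: nearW => v; have := @trig_dist 1 0 _ _ _ v re_t im_t.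
  by rewrite !eqxx/= /trig dcos0 !mul0r !mul1r !addr0; apply.
rewrite /transform /= z0 oppr0 sub0r opprK.
apply: le_trans (expect_norm_le m bs) _.
apply: ae_le_expect => //; first exact: bounded_measurable_norm.
apply: nearW => v; have := @trig_dist 0 1 _ _ _ v re_t im_t.
by rewrite !eqxx/= /trig dsin0 !mul0r !mul1r !add0r subr0; rewrite orbT; apply.
Qed.

End LST_continuity.

(** * The workload when the server is not serving *)

Section nonserving.
Context {R : realType}.

Lemma measurable_workload1 : measurable_fun [set: R * R * queue] (@workload1 R).
Proof. exact: (measurableT_comp measurable_fst measurable_fst). Qed.

Lemma measurable_not_serving1 : measurable (@not_serving1 R).
Proof.
have -> : @not_serving1 R = snd @^-1` [set queue2] `|`
    (snd @^-1` [set queue1] `&` @workload1 R @^-1` [set 0]).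
  by apply/seteqP; split => x [|[]]; [left|right|left|right].
apply: measurableU; last apply: measurableI.
- by rewrite -[_ @^-1` _]setTI; exact: measurable_snd.
- by rewrite -[_ @^-1` _]setTI; exact: measurable_snd.
- by rewrite -[_ @^-1` _]setTI; exact: measurable_workload1.
Qed.

Context {d : measure_display} {T : measurableType d}.
Variables (P : probability T R) (pst : probability (R * R * queue)%type R).
Variables (V : queue -> R -> T -> R) (J : R -> T -> queue).
Hypothesis stationary : has_law P (polling_state V J 0) pst.
Hypothesis V0_ge0 : {ae P, forall w, 0 <= V queue1 0 w}.

Let V0 := V queue1 0.
Let J0 := J 0.

Let mX : measurable_fun [set: T] (fun w => (V0 w, J0 w)).
Proof.
have [mst _] := stationary; apply: measurable_fun_pair.
  exact: (measurableT_comp measurable_workload1 mst).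
exact: (measurableT_comp measurable_snd mst).
Qed.

Let mV0 : measurable_fun [set: T] V0 := measurableT_comp measurable_fst mX.
Let mJ0 : measurable_fun [set: T] J0 := measurableT_comp measurable_snd mX.

(** When the server idles at queue 1 the workload is 0, so [g] contributes the constant [g 0].
    Nonnegativity identifies [V0 w = 0] with [~~ (0 < V0 w)] almost surely. *)
Lemma expect_not_serving1 (g : R -> R) : bounded_measurable g ->
  \int[pst]_x (\1_(@not_serving1 R) x * g (workload1 x)) =
  g 0 * idle_mass P V0 J0 + \int[P]_w ((J0 w == false)%:R * g (V0 w)).
Proof.
move=> bg.
have b1 : bounded_measurable (\1_(@not_serving1 R) : R * R * queue -> R).
  split; first by apply: measurable_indic; exact: measurable_not_serving1.
  by exists 1 => x; rewrite indicE; case: (_ \in _); rewrite ?normr1 ?normr0.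
have bG : bounded_measurable (fun x => \1_(@not_serving1 R) x * g (workload1 x)).
  by apply: bounded_measurableM => //; exact: (bounded_measurable_comp bg measurable_workload1).
have bz : bounded_measurable (fun w => (J0 w && ~~ (0 < V0 w))%:R : R).
  apply: bounded_measurable_bool; apply: measurable_and => //.
  by apply: measurable_neg; exact: measurable_fun_ltr.
have bj : bounded_measurable (fun w => (J0 w == false)%:R * g (V0 w)).
  apply: bounded_measurableM; last exact: bounded_measurable_comp.
  exact: bounded_measurable_eqb.
have bgz : bounded_measurable (fun w => g 0 * (J0 w && ~~ (0 < V0 w))%:R).
  by apply: bounded_measurableM => //; exact: bounded_measurable_cst.
rewrite -(expect_has_law stationary bG) -(expectZl P _ bz) -expectD//.
apply: ae_eq_expect.
- by case: (bounded_measurable_comp bG stationary.1).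
- by case: (bounded_measurableD bgz bj).
apply: filterS V0_ge0 => w v0; rewrite indicE /polling_state /workload1/= -/V0 -/(J0 w).
have -> : ((V0 w, V queue2 0 w, J0 w) \in @not_serving1 R) =
    (J0 w == false) || (J0 w && ~~ (0 < V0 w)).
  apply/idP/idP; rewrite inE /not_serving1 /workload1/=.
    by case=> [->//|[-> ->]]; rewrite ltxx.
  case: (J0 w) => /= h; last by left.
  by right; split => //; apply/eqP; rewrite eq_le v0 andbT leNgt.
case: (J0 w) => /=; last by rewrite mul1r mulr0 add0r.
rewrite mul0r addr0; case: ltP => // v1; rewrite /= ?mulr0 ?mul0r// mul1r mulr1.
by congr g; apply/eqP; rewrite eq_le v0 v1.
Qed.

Lemma not_serving1_mass : fine (pst (@not_serving1 R)) =
  idle_mass P V0 J0 + \int[P]_w ((J0 w == false)%:R : R).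
Proof.
have := expect_not_serving1 (bounded_measurable_cst 1).
rewrite mul1r; under [X in _ = _ + X -> _]eq_Rintegral do rewrite mulr1.
move=> <-; under eq_Rintegral do rewrite mulr1.
rewrite /Rintegral integral_indic ?setIT//; exact: measurable_not_serving1.
Qed.

Variable nu : probability R R.
Hypothesis nu_cond : is_conditional_law pst (@workload1 R) (@not_serving1 R) nu.
Hypothesis mass_gt0 : 0 < idle_mass P V0 J0 + \int[P]_w ((J0 w == false)%:R : R).

Lemma not_serving1_gt0 : (0 < pst (@not_serving1 R))%E.
Proof.
rewrite -[X in (_ < X)%E]fineK ?lte_fin ?not_serving1_mass//.
by rewrite fin_num_measure//; exact: measurable_not_serving1.
Qed.

Lemma nu_ge0 : {ae nu, forall x, 0 <= x}.
Proof.
have mN : measurable (`]-oo, 0[%classic : set R) by exact: measurable_itv.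
apply/ae_ge0P; rewrite nu_cond//.
suff -> : pst (@workload1 R @^-1` `]-oo, 0[%classic `&` @not_serving1 R) = 0%E.
  by rewrite mul0e.
have VX : has_law P V0 (distribution pst (HB.pack (@workload1 R)
    (isMeasurableFun.Build _ _ _ _ _ measurable_workload1) : {mfun (R * R * queue)%type >-> R})).
  split=> // A mA; have [_ Xpst] := stationary.
  rewrite /distribution /pushforward /= -Xpst//.
  by rewrite -[_ @^-1` _]setTI; exact: measurable_workload1.
have /ae_ge0P W0 := (has_law_ae_ge0 VX).1 V0_ge0.
apply/eqP; rewrite eq_le measure_ge0 andbT -W0 /distribution /pushforward /=.
have mWN : measurable (@workload1 R @^-1` `]-oo, 0[%classic).
  by rewrite -[_ @^-1` _]setTI; exact: measurable_workload1.
rewrite le_measure ?inE//.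
by apply: measurableI => //; exact: measurable_not_serving1.
Qed.

Lemma expect_nu (g : R -> R) : bounded_measurable g ->
  \int[nu]_y g y = (g 0 * idle_mass P V0 J0 + \int[P]_w ((J0 w == false)%:R * g (V0 w)))
    / (idle_mass P V0 J0 + \int[P]_w ((J0 w == false)%:R : R)).
Proof.
move=> bg; rewrite (expect_conditional measurable_workload1 measurable_not_serving1
  not_serving1_gt0 nu_cond bg).
by rewrite expect_not_serving1// not_serving1_mass mulrC.
Qed.

End nonserving.

(** * The decomposition *)

Section sum_of_independent.
Context {R : realType}.

(* On [0, oo[, [pexp] turns the sum into a product. *)
Lemma laplace_convolution (mu nu m : probability R R) :
  {ae mu, forall x, 0 <= x} -> {ae nu, forall x, 0 <= x} -> {ae m, forall x, 0 <= x} ->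
  (forall n, \int[m]_v (pexp v ^+ n) = \int[mu]_v (pexp v ^+ n) * \int[nu]_v (pexp v ^+ n)) ->
  exists (d : measure_display) (T : measurableType d) (P : probability T R)
         (X Y : {RV P >-> R}),
    [/\ has_law P X mu, has_law P Y nu, independent_pair P X Y &
        forall A : set R, measurable A -> m A = P [set w | A (X w + Y w)]].
Proof.
move=> mu_ge0 nu_ge0 m_ge0 mE.
pose P : probability (R * R)%type R := (mu \x nu)%E.
have PX A B : measurable A -> measurable B -> P (A `*` B) = (mu A * nu B)%E.
  by move=> mA mB; exact: product_measure1E.
pose X : {RV P >-> R} := HB.pack (@fst R R)
  (isMeasurableFun.Build _ _ _ _ (@fst R R) measurable_fst).
pose Y : {RV P >-> R} := HB.pack (@snd R R)
  (isMeasurableFun.Build _ _ _ _ (@snd R R) measurable_snd).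
have lX : has_law P X mu.
  split; first exact: measurable_fst.
  move=> A mA; have -> : X @^-1` A = A `*` setT by apply/seteqP; split => x /=; [|case].
  by rewrite PX// probability_setT mule1.
have lY : has_law P Y nu.
  split; first exact: measurable_snd.
  move=> A mA; have -> : Y @^-1` A = setT `*` A by apply/seteqP; split => x /=; [|case].
  by rewrite PX// probability_setT mul1e.
have iXY : independent_pair P X Y.
  move=> A B mA mB; rewrite lX.2// lY.2// -PX//.
exists _, _, P, X, Y; split=> // A mA.
have mS : measurable_fun [set: R * R] (fun w => X w + Y w).
  by apply: measurable_funD; [exact: measurable_fst|exact: measurable_snd].
pose S : {RV P >-> R} := HB.pack (fun w => X w + Y w)
  (isMeasurableFun.Build _ _ _ _ (fun w => X w + Y w) mS).
have lS : has_law P S (distribution P S) by split.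
have X0 := (has_law_ae_ge0 lX).2 mu_ge0; have Y0 := (has_law_ae_ge0 lY).2 nu_ge0.
apply: (@laplace_unique _ m (distribution P S)) mA => //.
  by apply: (has_law_ae_ge0 lS).1; apply: filterS2 X0 Y0 => w; exact: addr_ge0.
move=> n; rewrite mE.
have bn := @bounded_measurable_pexpX R n.
rewrite -(expect_has_law lS bn) -(expect_has_law lX bn) -(expect_has_law lY bn).
rewrite -(independent_pair_expectM measurable_fst measurable_snd iXY bn bn).
apply: ae_eq_expect.
- apply: (bounded_measurableM _ _).1.
    exact: (bounded_measurable_comp bn measurable_fst).
  exact: (bounded_measurable_comp bn measurable_snd).
- by case: (bounded_measurable_comp bn mS).
apply: filterS2 X0 Y0 => w x0 y0.
by rewrite /pexp !max_l ?addr_ge0// opprD expRD exprMn.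
Qed.

End sum_of_independent.

Lemma ae_pos_ge0 {R : realType} (B : probability R R) :
  B [set x : R | 0 < x] = 1%E -> {ae B, forall x, 0 <= x}.
Proof.
move=> B1; have mpos : measurable [set x : R | 0 < x].
  by rewrite -[X in measurable X](_ : `]0, +oo[%classic = _);
    [exact: measurable_itv|apply/seteqP; split => x /=; rewrite in_itv/= andbT].
exists (~` [set x : R | 0 < x]); split; first exact: measurableC.
  by rewrite probability_setC// B1 subee.
by move=> x /= h x0; apply: h; exact: ltW.
Qed.

Lemma dcos_max0 {R : realType} (a b : R) : dcos a b (Num.max 0 0) = 1.
Proof. by rewrite max_l// dcos0. Qed.

Lemma dsin_max0 {R : realType} (a b : R) : dsin a b (Num.max 0 0) = 0.
Proof. by rewrite max_l// dsin0. Qed.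

(** Links the uniqueness statement to the balance equations at [s = n]. *)
Lemma pexpX {R : realType} (v : R) n : pexp v ^+ n = pcos n%:R 0 v.
Proof. by rewrite pcos_real /pexp -expRM_natl mulrN. Qed.

Local Open Scope complex_scope.

(** [den] is the determinant of the linear system in [x] and [y]. Eliminating [y] gives
    [den * x = - (s * p0 * (al + c2))], whose right side is nonzero, and this forces [den != 0]. *)
Lemma transform_algebra {F : fieldType} (s al c1 c2 p0 x y : F) :
  let den := (c2 + c1 - s) * al + al ^+ 2 - s * c2 in
  al * x + c1 * x = c2 * y + s * (x - p0) -> al * y + c2 * y = c1 * x ->
  s != 0 -> p0 != 0 -> al + c2 != 0 -> den != 0 /\ den * y = - (c1 * s * p0).
Proof.
move=> den e1 e2 s0 p00 al0.
have dx : den * x = - (s * p0 * (al + c2)).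
  apply/eqP; rewrite -subr_eq0; apply/eqP.
  transitivity ((al + c2) * (al * x + c1 * x - (c2 * y + s * (x - p0)))
    + c2 * (al * y + c2 * y - c1 * x)); first by rewrite /den; ring.
  by rewrite e1 e2 !subrr !mulr0 addr0.
split.
  apply/eqP => den0; move/eqP: dx; rewrite den0 mul0r eq_sym oppr_eq0.
  by rewrite !mulf_eq0 (negbTE s0) (negbTE p00) (negbTE al0).
apply: (mulfI al0); transitivity (c1 * (den * x)); last by rewrite dx; ring.
by transitivity (den * (al * y + c2 * y)); [ring|rewrite e2; ring].
Qed.

Theorem corollary4p0p1 (R : realType)
  (lambda c : queue -> R) (B : queue -> probability R R)
  (pst : probability (R * R * queue)%type R) (mu nu : probability R R)
  (lambda_gt0 : forall i, 0 < lambda i)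
  (c_gt0 : forall i, 0 < c i)
  (B_pos : forall i, B i [set x : R | 0 < x] = 1%E)
  (B_mean : forall i, (mean (B i) < +oo)%E) :
  let rho i := lambda i * fine (mean (B i)) in
  let c1 := c queue1 in
  let c2 := c queue2 in
  rho queue1 < c2 / (c1 + c2) ->
  rho queue2 < c1 / (c1 + c2) ->
  polling_steady_state lambda c B pst ->
  mg1_steady_state (lambda queue1) (B queue1) mu ->
  is_conditional_law pst (@workload1 R) (@not_serving1 R) nu ->
  (exists (d : measure_display) (T : measurableType d) (P : probability T R)
          (VMG1 Y : {RV P >-> R}),
      [/\ has_law P VMG1 mu,
          has_law P Y nu,
          independent_pair P VMG1 Y &
          forall A : set R, measurable A ->
            pst (@workload1 R @^-1` A) = P [set w | A (VMG1 w + Y w)]])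
  /\
  (let a (s : R[i]) : R[i] := (lambda queue1)%:C * (1 - LST (B queue1) s) in
   let den (s : R[i]) : R[i] :=
     (c2%:C + c1%:C - s) * a s + a s ^+ 2 - s * c2%:C in
   let F (s : R[i]) : R[i] :=
     (c2 - rho queue1 * (c1 + c2))%:C / ((1 - rho queue1) * (c1 + c2))%:C
     * (1 - s * c1%:C / den s) in
   (forall s : R[i], 0 <= complex.Re s -> s != 0 ->
      den s != 0 /\ LST nu s = F s)
   /\ (F : R[i]^o -> R[i]^o) s
        @[s --> within [set s : R[i]^o | 0 <= complex.Re s] (0 : R[i]^o)^']
        --> (LST nu 0 : R[i]^o)).
Proof.
move=> rho c1 c2 rho1_lt _ [d [T [P [inter [serv [resid [V [J [process stat]]]]]]]]].
move=> [d' [T' [P' [inter' [serv' [W [process' stat']]]]]]] nu_cond.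
pose lam := lambda queue1; pose V0 := V queue1 0; pose J0 := J 0.
pose S := serv queue1 0%N; pose S' := serv' 0%N.
have B_ge0 := ae_pos_ge0 (B_pos queue1).
have law0 := stat 0 (lexx 0).
have [mV0 mJ0] := polling_measurable stat (lexx 0).
have V0_ge0 := polling_workload1_ge0 process.
have SB : has_law P S (B queue1) := polling_service_law process queue1 0.
have SB' : has_law P' S' (B queue1) := mg1_service_law process' 0.
have S_ge0 := (has_law_ae_ge0 SB).2 B_ge0.
have S'_ge0 := (has_law_ae_ge0 SB').2 B_ge0.
have indep := polling_initial_serv_independent process.
have gen : generator_identity P lam c V0 S J0.
  move=> f K L df fK fL mf dfE bdf.
  exact: (polling_generator fK fL mf dfE bdf lambda_gt0 c_gt0 process stat).
have W_law := stat' 0 (lexx 0).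
have mW : measurable_fun [set: T'] (W 0) := W_law.1.
have W_ge0 := mg1_workload_ge0 process'.
have mJ' : measurable_fun [set: T'] (fun=> true) := measurable_cst true.
have indep' := mg1_initial_serv_independent process'.
have gen' : generator_identity P' lam (fun=> 0) (W 0) S' (fun=> true).
  move=> f K L df fK fL mf dfE bdf; rewrite !mul0r !addr0.
  exact: (mg1_generator fK fL mf dfE bdf (lambda_gt0 queue1) process' stat').
have bal := real_balance gen mV0 mJ0 V0_ge0 SB S_ge0 indep.
have bal' := real_balance gen' mW mJ' W_ge0 SB' S'_ge0 indep'.
have idle := idle_mass_eq gen mV0 mJ0 V0_ge0 SB B_ge0 (B_mean queue1) S_ge0 indep.
have idle' := idle_mass_eq gen' mW mJ' W_ge0 SB' B_ge0 (B_mean queue1) S'_ge0 indep'.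
have switch := switch_balance gen mV0 mJ0 V0_ge0 SB S_ge0 indep.
have mass1 := state_mass P mJ0.
set p0 := idle_mass P V0 J0 in bal idle.
set q0 := idle_mass P' (W 0) (fun=> true) in bal' idle'.
set P1 := \int[P]_w ((J0 w == true)%:R : R) in idle switch mass1.
set P2 := \int[P]_w ((J0 w == false)%:R : R) in idle switch mass1.
rewrite -/(rho queue1) mass1 mulr1 in idle.
(* With the position constantly [true], the two position probabilities are 1 and 0. *)
have q0E : q0 = 1 - rho queue1.
  rewrite idle' [X in X - _](expect_cst P' 1) [X in _ * (X + _)](expect_cst P' 1).
  by rewrite [X in _ * (_ + X)](expect_cst P' 0) addr0 mulr1.
have c12 : 0 < c1 + c2 by rewrite addr_gt0 ?c_gt0.
have c10 : 0 < c1 := c_gt0 queue1; have c20 : 0 < c2 := c_gt0 queue2.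
have P1E : P1 = c2 / (c1 + c2).
  apply: (mulIf (lt0r_neq0 c12)); rewrite divfK ?gt_eqF//.
  have sw : c1 * P1 = c2 * P2 := switch.
  have P2e : P2 = 1 - P1 by lra.
  by rewrite P2e in sw; lra.
have P2E : P2 = c1 / (c1 + c2).
  have -> : P2 = 1 - P1 by lra.
  by rewrite P1E; field; rewrite gt_eqF.
have p0E : p0 = (c2 - rho queue1 * (c1 + c2)) / (c1 + c2).
  by rewrite idle P1E; field; rewrite gt_eqF.
(* This is exactly the stability condition of queue 1. *)
have p0_gt0 : 0 < p0 by rewrite idle P1E subr_gt0.
(* The probability of not serving queue 1, by which the law of [Y] is normalised. *)
have massE : p0 + P2 = 1 - rho queue1 by lra.
have mass_gt0 : 0 < p0 + P2 by rewrite addr_gt0// P2E divr_gt0.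
have nu_ge0 := nu_ge0 law0 V0_ge0 nu_cond.
have nuE g (bg : bounded_measurable g) := expect_nu law0 V0_ge0 nu_cond mass_gt0 bg.
split.
  pose W1 : {mfun (R * R * queue)%type >-> R} := HB.pack (@workload1 R)
    (isMeasurableFun.Build _ _ _ _ _ (@measurable_workload1 R)).
  have lV : has_law P V0 (distribution pst W1).
    split=> // A mA; rewrite /distribution /pushforward /= -law0.2//.
    by rewrite -[_ @^-1` _]setTI; exact: measurable_workload1.
  have mu_ge0 := (has_law_ae_ge0 W_law).1 W_ge0.
  apply: (laplace_convolution mu_ge0 nu_ge0 ((has_law_ae_ge0 lV).1 V0_ge0)) => n.
  have bn := @bounded_measurable_pexpX R n.
  rewrite -(expect_has_law lV bn) -(expect_has_law W_law bn) nuE//.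
  (* At [n = 0] the balance equations carry no information, and the claim is only about total
     masses. *)
  have [->|n0] := posnP n.
    under eq_Rintegral do rewrite expr0.
    under [in X in _ = X * _]eq_Rintegral do rewrite expr0.
    rewrite !(expect_cst _ 1) expr0 !mul1r -/p0.
    under eq_Rintegral do rewrite expr0 mulr1.
    by rewrite -/P2 divff// gt_eqF.
  have a0 : 0 < n%:R :> R by rewrite ltr0n.
  pose al := lam * (1 - \int[B queue1]_x pcos n%:R 0 x).
  pose Lt := cos_part P V0 J0 n%:R 0 true; pose Lf := cos_part P V0 J0 n%:R 0 false.
  pose psi := cos_part P' (W 0) (fun=> true) n%:R 0 true.
  have et : al * Lt + c1 * Lt = c2 * Lf + n%:R * (Lt - p0).
    by have := bal n%:R true (ltW a0); rewrite /= mul1r.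
  have ef : al * Lf + c2 * Lf = c1 * Lt.
    by have := bal n%:R false (ltW a0); rewrite /= !mul0r addr0.
  have epsi : al * psi = n%:R * (psi - q0).
    by have := bal' n%:R true (ltW a0); rewrite /= !mul0r mul1r addr0 add0r.
  have -> : \int[P]_w pexp (V0 w) ^+ n = Lt + Lf.
    have bL j : bounded_measurable (fun w => (J0 w == j)%:R * pcos n%:R 0 (V0 w)).
      apply: bounded_measurableM; last first.
        exact: (bounded_measurable_comp (bounded_measurable_pcos 0 (ltW a0)) mV0).
      exact: bounded_measurable_eqb.
    rewrite /Lt /Lf /cos_part -expectD//; apply: eq_Rintegral => w _.
    by rewrite pexpX; case: (J0 w) => /=; rewrite mul1r mul0r ?addr0 ?add0r.
  have -> : \int[P']_w pexp (W 0 w) ^+ n = psi.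
    by apply: eq_Rintegral => w _; rewrite pexpX /= mul1r.
  have -> : \int[P]_w ((J0 w == false)%:R * pexp (V0 w) ^+ n) = Lf.
    by apply: eq_Rintegral => w _; rewrite pexpX.
  rewrite pexpX [pcos _ _ _]dcos_max0 mul1r massE -/p0.
  have r1 : 1 - rho queue1 != 0 by rewrite -massE gt_eqF.
  have epsi' : (n%:R - al) * psi = n%:R * (1 - rho queue1) by rewrite -q0E; lra.
  (* A zero factor would contradict [epsi'], whose right side is nonzero. *)
  have ne : n%:R - al != 0.
    apply/eqP => z; move/eqP: epsi'; rewrite z mul0r eq_sym mulf_eq0 (negbTE r1) orbF.
    by rewrite (gt_eqF a0).
  apply: (mulfI ne); rewrite [RHS]mulrA epsi'.
  (* The sum of [et] and [ef]: the switching terms cancel. *)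
  have -> : (n%:R - al) * (Lt + Lf) = n%:R * (p0 + Lf) by lra.
  by field.
have LST_nu s : 0 <= complex.Re s -> LST nu s =
    (p0%:C + state_transform P V0 J0 false s) / (1 - rho queue1)%:C.
  move=> s0; rewrite (LST_transform nu_ge0) /transform.
  rewrite (nuE _ (bounded_measurable_pcos (complex.Im s) s0)).
  rewrite (nuE _ (bounded_measurable_psin (complex.Im s) s0)).
  rewrite [pcos _ _ 0]dcos_max0 [psin _ _ 0]dsin_max0 -/p0 massE mul1r mul0r add0r.
  by rewrite -fmorphV /state_transform; apply/eqP; rewrite eq_complex; simpc => /=.
move=> a den F; have main s : 0 <= complex.Re s -> s != 0 -> den s != 0 /\ LST nu s = F s.
  move=> s0 sn0.
  have aE : a s = lam%:C * (1 - transform P S s).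
    by rewrite /a (LST_transform B_ge0) (transform_has_law s0 SB).
  have et := complex_balance gen mV0 SB.1 mJ0 V0_ge0 S_ge0 indep true s0.
  have ef := complex_balance gen mV0 SB.1 mJ0 V0_ge0 S_ge0 indep false s0.
  rewrite -aE /= mul1r in et; rewrite -aE /= !mul0r addr0 in ef.
  have p00 : (idle_mass P V0 J0)%:C != 0 :> R[i] by rewrite eq_complex /= eqxx andbT gt_eqF.
  (* The real part is at least [c2], because a transform has real part at most 1 on the
     half-plane. *)
  have a_c2 : a s + (c queue2)%:C != 0.
    apply/eqP => /(congr1 (@complex.Re R)).
    have : 0 < lam * (1 - \int[P]_w pcos (complex.Re s) (complex.Im s) (S w)) + c2.
      rewrite ltr_wpDl// mulr_ge0 ?(ltW (lambda_gt0 _))// subr_ge0.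
      rewrite -[leRHS](expect_cst P 1); apply: ae_le_expect.
      - exact: (bounded_measurable_comp (bounded_measurable_pcos _ s0) SB.1).
      - exact: bounded_measurable_cst.
      - apply: nearW => w; rewrite (le_trans (ler_norm _))// dcos_le1//.
        by rewrite le_max lexx orbT.
    by rewrite aE /transform; simpc => /= h; rewrite ?subr0 ?mul0r ?subr0 => e;
      rewrite e ltxx in h.
  have [den0 yE] := transform_algebra et ef sn0 p00 a_c2.
  split=> //; rewrite LST_nu// /F.
  have yE' : state_transform P V0 J0 false s = - ((c queue1)%:C * s * p0%:C) / den s.
    by apply: (mulfI den0); rewrite yE mulrCA divff// mulr1.
  have r1 : (1 - rho queue1)%:C != 0 :> R[i].
    by rewrite eq_complex /= eqxx andbT -massE gt_eqF.
  have k0 : (c1 + c2)%:C != 0 :> R[i] by rewrite eq_complex /= eqxx andbT gt_eqF.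
  (* The numerator of the constant in [F] is [p0] times [c1 + c2]. *)
  rewrite yE' [X in _ = X / _ * _](_ : _ = p0%:C * (c1 + c2)%:C); last first.
    by rewrite -rmorphM p0E divfK// gt_eqF.
  rewrite rmorphM; field.
  apply/and3P; split; first exact: den0.
    by move: k0; rewrite rmorphD.
  by move: r1; rewrite rmorphB rmorph1.
split=> //.
(* On the punctured half-plane [F] coincides with the transform of [nu], so its limit at 0 is given
   by the continuity of that transform. *)
apply: cvg_trans (LST_cvg0 nu_ge0); apply: near_eq_cvg.
suff : \forall s \near nbhs (0 : R[i]^o), s != 0 -> 0 <= complex.Re s -> LST nu s = F s.
  by apply: filterS => s h s0 ?; exact: h.
by apply: nearW => s s0 re0; have [] := main s re0 s0.
Qed.
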